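(* Let $k$ be a field of characteristic zero, let $A = k[x,y]$ be the polynomial algebra in two commuting variables over $k$, and let $D$ be any locally finite $k$-derivation of $A$. Then the image $\operatorname{Im} D := D(A)$ is a Mathieu subspace of $A$.
   Context: A $k$-derivation $D$ of $A$ is called locally finite if for every $a \in A$ the $k$-vector space spanned by the elements $D^i a$ ($i \ge 1$) is finite dimensional. Let $R$ be a commutative $k$-algebra (with unit). A $k$-subspace $M$ of $R$ is called a Mathieu subspace of $R$ if the following holds: whenever $a \in R$ satisfies $a^m \in M$ for all $m \ge 1$, then for every $b \in R$ there exists $N \in \mathbb{N}$ such that $b a^m \in M$ for all $m \ge N$. *)

(* Defs.v *)
From HB Require Import structures.
From mathcomp Require Import all_boot all_algebra.
From mathcomp Require Import mpoly.

Set Implicit Arguments.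
Unset Strict Implicit.
Unset Printing Implicit Defensive.

Import GRing.Theory.
Local Open Scope ring_scope.

(* Subsets of the infinite-dimensional algebras considered here (images, spans)
   are not decidable in general, so they are Prop-valued predicates rather than
   the boolean predicates used by [GRing.submod_closed] and [{vspace _}]. *)

Definition is_subspace (k : fieldType) (V : lmodType k) (M : V -> Prop) : Prop :=
  M 0 /\ forall (c : k) (u v : V), M u -> M v -> M (c *: u + v).

Definition span_of (k : fieldType) (V : lmodType k) (S : V -> Prop) : V -> Prop :=
  fun v => exists (n : nat) (c : 'I_n -> k) (s : 'I_n -> V),
    (forall i, S (s i)) /\ v = \sum_(i < n) c i *: s i.

Definition finite_dimensional (k : fieldType) (V : lmodType k)
    (W : V -> Prop) : Prop :=
  exists (n : nat) (e : 'I_n -> V),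
    (forall i, W (e i)) /\
    (forall w, W w -> exists c : 'I_n -> k, w = \sum_(i < n) c i *: e i).

Definition leibniz (k : fieldType) (A : comAlgType k) (D : A -> A) : Prop :=
  forall a b : A, D (a * b) = D a * b + a * D b.

Definition locally_finite (k : fieldType) (A : comAlgType k) (D : A -> A) : Prop :=
  forall a : A,
    finite_dimensional
      (span_of (fun b : A => exists i : nat, (1 <= i)%N /\ b = iter i D a)).

Definition mathieu_subspace (k : fieldType) (R : comAlgType k)
    (M : R -> Prop) : Prop :=
  is_subspace M /\
  forall a : R, (forall m : nat, (1 <= m)%N -> M (a ^+ m)) ->
  forall b : R, exists N : nat, forall m : nat, (N <= m)%N -> M (b * a ^+ m).

Definition image_of (T U : Type) (f : T -> U) : U -> Prop :=
  fun y => exists x : T, f x = y.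

(* Main.v *)
Require Import Defs.
From HB Require Import structures.
From mathcomp Require Import all_boot all_algebra all_field.
From mathcomp Require Import mpoly ring zify.
From mathcomp Require boolp.

Set Implicit Arguments.
Unset Strict Implicit.
Unset Printing Implicit Defensive.

Import GRing.Theory.
Local Open Scope ring_scope.

(** Write A = k[x,y].  After a finite extension of k, A becomes the direct sum of
the generalized eigenspaces A_c of D ([decomposable_all]), with A_c A_d contained
in A_(c+d) ([weightM]), and on A_c the derivation D is c plus a locally nilpotent
derivation N ([nilpart]).  Such an extension is harmless, because a k-linear
retraction k' -> k commutes with D and so carries solutions of D v = a back to k
([retp_der]).  D is bijective on A_c for c <> 0, hence Im D is the sum of all A_c
with c <> 0 and of N(A_0), and only the weight 0 part is in question.  There are
four cases.

If A_0 = k, then N(A_0) = 0, and the sum Im D of the A_c with c <> 0 is an ideal: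
a product of vectors of opposite nonzero weights lies in k, and it vanishes, since
otherwise both factors would be units ([case_constant_weight0]).

If A_0 is larger than k and N = 0, any three elements of A are algebraically
dependent over k ([algebraic_dependence3]); applied to a nonconstant element of
A_0 and two weight vectors, this makes all weights multiples of a single one.  An
element f is then a Laurent polynomial in one variable T over A, and the powers
f^m lie in Im D exactly when their constant terms vanish.  The one-variable case
of the theorem of Duistermaat and van der Kallen ([dvdk]) says that f has only
positive or only negative exponents, so g f^m has no constant term for large m
([case_semisimple]).

If A_0 is larger than k, N <> 0 and a nonzero weight occurs, the kernel of N has
transcendence degree 1 and contains a vector of nonzero weight, so its weight 0
part is k ([ker0_const]).  Hence N maps some element of A_0 to a nonzero
constant, D has a slice, and D is onto ([case_slice]).

If 0 is the only weight, D is locally nilpotent, and Im D is an ideal by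
Rentschler's theorem ([lnd_image_ideal]).  Take s with D s = h <> 0 and D h = 0,
and lower the degree of h until h is constant and D is onto.  An irreducible
factor q of h lies in Ker D.  If q divides all values of D, replace D by D/q,
whose image differs by the factor q.  Otherwise D induces a nonzero derivation on
the domain A/q, whose kernel is algebraic over k because A/q has transcendence
degree 1; it contains the class of s, so p(s) is in qA for some nonzero
polynomial p ([algebraic_mod]).  Over a splitting field of p, a factor q' of q divides s - r
for a root r, and (s - r) / q' is a better choice of s.

For [dvdk], let f = T^-a p(T) with p(0) <> 0 and deg p > a > 0, and assume that
f, f^2, ... have zero constant terms.  Then log(1 - z f) splits into its parts of
positive and of negative exponents in T, and exponentiating yields a
factorization T^a - z p = W V over K[[z]] with W monic of degree a in T and
W(0) = - p(0) z ([wiener_hopf], [series_factorization]).  The roots of W are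
roots of p - z^-1 T^a, a polynomial of degree deg p > a with constant leading
coefficient, so they are integral over K[z^-1]; hence so is their product, which
is z up to a constant.  But z is not integral over K[z^-1]
([svar_not_integral]). *)

(** * Formal power series *)

Record series (R : Type) := Series { scoef : nat -> R }.

Lemma seriesP (R : Type) (s t : series R) : scoef s =1 scoef t -> s = t.
Proof.
by case: s t => [s] [t] /= /boolp.funext ->.
Qed.

HB.instance Definition _ (R : Type) := boolp.gen_eqMixin (series R).
HB.instance Definition _ (R : Type) := boolp.gen_choiceMixin (series R).

Section SeriesRing.
Variable R : comNzRingType.
Implicit Types s t u : series R.

Definition saddr s t := Series (fun n => scoef s n + scoef t n).
Definition soppr s := Series (fun n => - scoef s n).
Definition szero : series R := Series (fun=> 0).
Definition sone : series R := Series (fun n => (n == 0)%:R).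
Definition smulr s t := Series (fun n => \sum_(i < n.+1) scoef s i * scoef t (n - i)%N).

Fact saddA : associative saddr.
Proof. by move=> s t u; apply: seriesP => n /=; rewrite addrA. Qed.
Fact saddC : commutative saddr.
Proof. by move=> s t; apply: seriesP => n /=; rewrite addrC. Qed.
Fact sadd0 : left_id szero saddr.
Proof. by move=> s; apply: seriesP => n /=; rewrite add0r. Qed.
Fact saddN : left_inverse szero soppr saddr.
Proof. by move=> s; apply: seriesP => n /=; rewrite addNr. Qed.
HB.instance Definition _ := GRing.isZmodule.Build (series R) saddA saddC sadd0 saddN.

Definition series_trunc s (n : nat) : {poly R} := \poly_(i < n) scoef s i.

Fact smulE s t n : scoef (smulr s t) n = (series_trunc s n.+1 * series_trunc t n.+1)`_n.
Proof.
rewrite coefM /=; apply: eq_bigr => i _; rewrite !coef_poly ltn_ord.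
by rewrite ltnS leq_subr.
Qed.

Fact smulEwide s t n m : (n < m)%N ->
  scoef (smulr s t) n = (series_trunc s m * series_trunc t m)`_n.
Proof.
move=> nm; rewrite coefM /=; apply: eq_bigr => i _; rewrite !coef_poly.
by rewrite (leq_trans (ltn_ord i)) // (leq_ltn_trans (leq_subr _ _)).
Qed.

Fact smulC : commutative smulr.
Proof. by move=> s t; apply: seriesP => n; rewrite !smulE mulrC. Qed.
(** Coefficients of index at most n only see truncations, so associativity is that
of polynomials. *)
Fact smulA : associative smulr.
Proof.
move=> s t u; apply: seriesP => n.
have H v w : (series_trunc (smulr v w) n.+1 * 1)`_n = (series_trunc v n.+1 * series_trunc w n.+1)`_n.
  by rewrite mulr1 coef_poly ltnSn smulE.
have key v w x : scoef (smulr v (smulr w x)) n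
    = (series_trunc v n.+1 * (series_trunc w n.+1 * series_trunc x n.+1))`_n.
  rewrite smulE !coefM; apply: eq_bigr => i _; congr (_ * _).
  by rewrite coef_poly ltnS leq_subr (@smulEwide _ _ _ n.+1) // ltnS leq_subr.
by rewrite key smulC key; congr (nth 0 (polyseq _) n); ring.
Qed.
Fact smul1 : left_id sone smulr.
Proof.
move=> s; apply: seriesP => n /=; rewrite big_ord_recl /= mul1r subn0 big1 ?addr0 //.
by move=> i _; rewrite mul0r.
Qed.
Fact smulD : left_distributive smulr saddr.
Proof.
move=> s t u; apply: seriesP => n /=; rewrite -big_split /=.
by apply: eq_bigr => i _; rewrite mulrDl.
Qed.
Fact sone_neq0 : sone != szero.
Proof.
apply/eqP => /(congr1 (fun s => scoef s 0)) /= /eqP.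
by rewrite oner_eq0.
Qed.
HB.instance Definition _ := GRing.Zmodule_isComNzRing.Build (series R)
  smulA smulC smul1 smulD sone_neq0.

Lemma scoefD s t n : scoef (s + t) n = scoef s n + scoef t n. Proof. by []. Qed.
Lemma scoefN s n : scoef (- s) n = - scoef s n. Proof. by []. Qed.
Lemma scoef0 n : scoef (0 : series R) n = 0. Proof. by []. Qed.
Lemma scoef1 n : scoef (1 : series R) n = (n == 0)%:R. Proof. by []. Qed.
Lemma scoefM s t n : scoef (s * t) n = \sum_(i < n.+1) scoef s i * scoef t (n - i)%N.
Proof. by []. Qed.
Lemma scoef_sum (I : Type) (r : seq I) (P : pred I) (F : I -> series R) n :
  scoef (\sum_(i <- r | P i) F i) n = \sum_(i <- r | P i) scoef (F i) n.
Proof. exact: (big_morph (fun s => scoef s n)). Qed.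

End SeriesRing.

Section SeriesDomain.
Variable R : idomainType.
Implicit Types s t u : series R.

Definition sunit s : bool := boolp.asbool (exists t, t * s = 1).
Definition sinv s : series R :=
  match boolp.pselect (exists t, t * s = 1) with
  | left h => sval (boolp.cid h) | right _ => s end.

Fact smulVr : {in sunit, left_inverse 1 sinv *%R}.
Proof.
move=> s /boolp.asboolP us; rewrite /sinv; case: boolp.pselect => // h.
exact: (svalP (boolp.cid h)).
Qed.
Fact sunitP s t : t * s = 1 -> sunit s.
Proof. by move=> h; apply/boolp.asboolP; exists t. Qed.
Fact sinv_out : {in [predC sunit], sinv =1 id}.
Proof.
move=> s /negP us; rewrite /sinv; case: boolp.pselect => // h.
by case: us; apply/boolp.asboolP.
Qed.
HB.instance Definition _ := GRing.ComNzRing_hasMulInverse.Build (series R)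
  smulVr sunitP sinv_out.

Lemma series_neq0P s : s != 0 -> exists2 n, scoef s n != 0 & forall m, (m < n)%N -> scoef s m = 0.
Proof.
move=> s0; have ex: exists n, scoef s n != 0.
  apply: boolp.contrapT => h; case/eqP: s0; apply: seriesP => n /=.
  by apply/eqP; apply/negPn/negP => hn; apply: h; exists n.
exists (ex_minn ex); first by case: ex_minnP.
case: ex_minnP => n _ hn m mn; apply/eqP/negPn/negP => /hn.
by rewrite leqNgt mn.
Qed.

Fact series_idomain : GRing.integral_domain_axiom (series R).
Proof.
move=> s t st0; apply/negPn/negP; rewrite negb_or => /andP[].
move=> /series_neq0P[n sn ns] /series_neq0P[m tm mt].
have := congr1 (fun u => scoef u (n + m)) st0; rewrite scoefM scoef0.
have nlt : (n < (n + m).+1)%N by rewrite ltnS leq_addr.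
rewrite (bigD1 (Ordinal nlt)) //= addKn big1 ?addr0.
  by move/eqP; rewrite mulf_eq0 (negPf sn) (negPf tm).
move=> i /eqP ine; have : (i : nat) != n by apply/eqP => h; apply: ine; apply/val_inj.
case: ltngtP => // [/ns -> _|ni _]; first by rewrite mul0r.
rewrite mt ?mulr0 //; have := ltn_ord i; lia.
Qed.
HB.instance Definition _ := GRing.ComUnitRing_isIntegral.Build (series R) series_idomain.

End SeriesDomain.

(** * Exponentials of series of polynomials *)

Section Euler.
Variable R : comNzRingType.
Implicit Types s t u : series R.
(** The derivation y d/dy, which, unlike d/dy, does not shift indices. *)
Definition euler s : series R := Series (fun n => scoef s n *+ n).

Lemma eulerM s t : euler (s * t) = euler s * t + s * euler t.
Proof.
apply: seriesP => n; rewrite scoefD !scoefM -big_split /= -sumrMnl.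
apply: eq_bigr => i _; rewrite mulrnAl mulrnAr -mulrnDr subnKC //.
by rewrite -ltnS ltn_ord.
Qed.

End Euler.

Section LowZero.
Variable C : comNzRingType.
Notation R := {poly C}.
Implicit Types p q : R.
(** Divisibility by 'X^m, in a form that makes sense term by term. *)
Definition low_zero (m : nat) (p : R) := forall j, (j < m)%N -> p`_j = 0.
Lemma low_zeroM m n p q : low_zero m p -> low_zero n q -> low_zero (m + n) (p * q).
Proof.
move=> hp hq j jl; rewrite coefM big1 // => i _.
case: (ltnP i m) => im; first by rewrite hp ?mul0r.
by rewrite hq ?mulr0 //; have := ltn_ord i; lia.
Qed.
Lemma low_zero_le m n p : (m <= n)%N -> low_zero n p -> low_zero m p.
Proof. by move=> mn h j jm; apply: h; apply: leq_trans mn. Qed.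
Lemma low_zero_sum (I : Type) (r : seq I) (F : I -> R) m :
  (forall i, low_zero m (F i)) -> low_zero m (\sum_(i <- r) F i).
Proof. by move=> h j jm; rewrite coef_sum big1 // => i _; apply: h. Qed.
Lemma low_zero_drop m p : low_zero m p -> drop_poly m p * 'X^m = p.
Proof.
move=> h; rewrite -[RHS](poly_take_drop m); suff -> : take_poly m p = 0 by rewrite add0r.
by apply/polyP => i; rewrite coef_take_poly coef0; case: ifP => // /h.
Qed.
End LowZero.

Section Exp.
Variable K : fieldType.
Hypothesis char0 : forall n, (n.+1)%:R != 0 :> K.
Notation R := {poly K}.

(** The coefficients e_n of the series with logarithmic Euler derivative A, from
n e_n = A_1 e_(n-1) + ... + A_n e_0.  The argument f is fuel that turns this
course-of-values recursion into a structural one. *)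
Fixpoint expf (A : nat -> R) (f n : nat) : R :=
  if f is f'.+1 then
    if n is m.+1 then
       ((m.+1)%:R : K)^-1 *: \sum_(i < m.+1) A i.+1 * expf A f' (m - i)%N
    else 1
  else 0.

Lemma expf_fuel A f g n : (n < f)%N -> (n < g)%N -> expf A f n = expf A g n.
Proof.
elim: f g n => [//|f IH] [//|g] [//|n] /= nf ng.
by congr (_ *: _); apply: eq_bigr => i _; rewrite (IH g) // (leq_ltn_trans (leq_subr _ _)).
Qed.

(** Indexed by the logarithmic Euler derivative A: this is exp of the integral of A dy/y, so that
the logarithm itself never has to be formed. *)
Definition sexp (A : series R) : series R := Series (fun n => expf (scoef A) n.+1 n).

Lemma sexp0 A : scoef (sexp A) 0 = 1. Proof. by []. Qed.
Lemma sexpS A n : scoef (sexp A) n.+1 =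
   ((n.+1)%:R : K)^-1 *: \sum_(i < n.+1) scoef A i.+1 * scoef (sexp A) (n - i)%N.
Proof.
have -> : scoef (sexp A) n.+1 = ((n.+1)%:R : K)^-1 *:
    \sum_(i < n.+1) scoef A i.+1 * expf (scoef A) n.+1 (n - i)%N by [].
congr (_ *: _); apply: eq_bigr => i _; congr (_ * _).
by apply: (@expf_fuel (scoef A) n.+1 (n - i).+1 (n - i)); rewrite ?ltnS // leq_subr.
Qed.

Lemma euler_sexp A : scoef A 0 = 0 -> euler (sexp A) = A * sexp A.
Proof.
move=> A0; apply: seriesP => -[|n].
  by rewrite scoefM big_ord1 A0 mul0r /= mulr0n.
rewrite scoefM big_ord_recl A0 mul0r add0r.
have -> : scoef (euler (sexp A)) n.+1 = scoef (sexp A) n.+1 *+ n.+1 by [].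
rewrite sexpS -scaler_nat scalerA mulfV ?char0 // scale1r.
by apply: eq_bigr => i _; rewrite lift0 subSS.
Qed.

Lemma mulrn_poly_eq0 n (x : R) : x *+ n.+1 = 0 -> x = 0.
Proof.
move/eqP; rewrite -scaler_nat scaler_eq0 (negPf (char0 _)) /=.
by move/eqP.
Qed.

(** The coefficient of index n+1 of s is determined by the lower ones, after division
by n+1.  Identities between exponentials thus reduce to comparing logarithmic
derivatives. *)
Lemma euler_sexp_inv A s : scoef A 0 = 0 -> scoef s 0 = 1 -> euler s = A * s ->
  s = sexp A.
Proof.
move=> A0 s0 ts; apply: seriesP => n; elim/ltn_ind: n => -[|n] IH; first by rewrite s0.
apply/eqP; rewrite -subr_eq0; apply/eqP/(@mulrn_poly_eq0 n).
rewrite mulrnBl; apply/eqP; rewrite subr_eq0; apply/eqP.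
have -> : scoef s n.+1 *+ n.+1 = scoef (euler s) n.+1 by [].
have -> : scoef (sexp A) n.+1 *+ n.+1 = scoef (euler (sexp A)) n.+1 by [].
rewrite ts euler_sexp // !scoefM big_ord_recl [RHS]big_ord_recl A0 !mul0r !add0r.
by apply: eq_bigr => i _; rewrite lift0 subSS IH // ltnS leq_subr.
Qed.

Lemma sexpD A B : scoef A 0 = 0 -> scoef B 0 = 0 -> sexp A * sexp B = sexp (A + B).
Proof.
move=> A0 B0; apply: euler_sexp_inv; first by rewrite scoefD A0 B0 addr0.
  by rewrite scoefM big_ord1 !sexp0 mul1r.
rewrite eulerM !euler_sexp //; ring.
Qed.

Lemma low_zeroZ m c (p : R) : low_zero m p -> low_zero m (c *: p).
Proof. by move=> h j jm; rewrite coefZ h ?mulr0. Qed.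
(** The bound is additive in the index, so the recursion preserves it.  With y = z T^-a
it says that the coefficient of z^n involves only positive powers of T. *)
Lemma sexp_low a A : (forall n, low_zero (a * n.+1).+1 (scoef A n.+1)) ->
  (forall n, low_zero (a * n) (scoef (sexp A) n)) /\
  (forall n, low_zero (a * n.+1).+1 (scoef (sexp A) n.+1)).
Proof.
move=> hA; have h n : low_zero (a * n) (scoef (sexp A) n) /\
    ((0 < n)%N -> low_zero (a * n).+1 (scoef (sexp A) n)).
  elim/ltn_ind: n => -[|n] IH; first by rewrite muln0.
  suff h : low_zero (a * n.+1).+1 (scoef (sexp A) n.+1).
    by split=> // ; apply: low_zero_le h.
  rewrite sexpS; apply: low_zeroZ; apply: low_zero_sum => i.
  have le_in : (i <= n)%N by rewrite -ltnS.
  have -> : (a * n.+1).+1 = ((a * i.+1).+1 + a * (n - i))%N by nia.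
  by apply: low_zeroM => //; apply: (IH _ _).1; rewrite ltnS leq_subr.
by split=> n; [exact: (h n).1 | exact: (h n.+1).2].
Qed.

(** The mirror image of [sexp_low]: with y = z T^-a, only negative powers of T occur. *)
Lemma size_sexp a (A : series R) : (forall n, (size (scoef A n.+1) <= a * n.+1)%N) ->
  (forall n, (size (scoef (sexp A) n) <= (a * n).+1)%N) /\
  (forall n, (size (scoef (sexp A) n.+1) <= a * n.+1)%N).
Proof.
move=> hA; have h n : (size (scoef (sexp A) n) <= (a * n).+1)%N /\
    ((0 < n)%N -> (size (scoef (sexp A) n) <= a * n)%N).
  elim/ltn_ind: n => -[|n] IH; first by rewrite muln0 sexp0 size_polyC oner_eq0.
  suff h : (size (scoef (sexp A) n.+1) <= a * n.+1)%N by split=> //; apply: leqW.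
  rewrite sexpS; apply: leq_trans (size_scale_leq _ _) _.
  apply: leq_trans (size_sum _ _ _) _; apply/bigmax_leqP => i _.
  apply: leq_trans (size_polyMleq _ _) _.
  have le_in : (i <= n)%N by rewrite -ltnS.
  have h1 := hA i; have [h2 _] := IH (n - i)%N (leq_ltn_trans (leq_subr _ _) (ltnSn n)).
  nia.
by split=> n; [exact: (h n).1 | exact: (h n.+1).2].
Qed.

End Exp.

(** * Wiener-Hopf factorization *)

Section WienerHopf.
Variable K : fieldType.
Hypothesis char0 : forall n, (n.+1)%:R != 0 :> K.
Notation R := {poly K}.
Variables (p : R) (a b : nat).
Hypothesis szp : (size p <= (a + b).+1)%N.
Hypothesis cst : forall m, (0 < m)%N -> (p ^+ m)`_(a * m) = 0.

(** Everything is written in y = z T^-a instead of z, which keeps coefficients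
polynomial in T: Q is 1 - z f for f = T^-a p, and [Alo], [Ahi] are the parts of
negative and positive exponents of its logarithmic derivative - sum of (z f)^m.
The assumption on the constant terms of f^m says that nothing is left in between. *)
Let Q : series R := Series (fun m => if m == 0%N then 1 : R else if m == 1 then - p else 0).
Let Ahi : series R := Series (fun m => if m == 0%N then 0 : R else
  - (drop_poly (a * m).+1 (p ^+ m) * 'X^((a * m).+1))).
Let Alo : series R := Series (fun m => if m == 0%N then 0 : R else
  - take_poly (a * m).+1 (p ^+ m)).

Let MQ (s : series R) n : scoef (s * Q) n.+1 = scoef s n.+1 - scoef s n * p.
Proof.
rewrite scoefM 2!big_ord_recr /= subnn subSnn /= mulr1 mulrN big1 ?add0r 1?addrC //.
move=> i _; have := ltn_ord i; case E : (n.+1 - i)%N => [|[|m]]; rewrite ?mulr0 //; lia.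
Qed.

Let AQ : (Alo + Ahi) * Q = euler Q.
Proof.
have A_E n : scoef (Alo + Ahi) n.+1 = - p ^+ n.+1.
  by rewrite scoefD /= -opprD poly_take_drop.
have A_0 : scoef (Alo + Ahi) 0 = 0 by rewrite scoefD /= addr0.
apply: seriesP => -[|n]; first by rewrite scoefM big_ord1 A_0 mul0r.
rewrite MQ A_E; case: n => [|n]; first by rewrite A_0 mul0r subr0 expr1.
by rewrite A_E mulNr opprK -exprSr addNr /= mul0rn.
Qed.

Let A0 : scoef Alo 0 = 0 /\ scoef Ahi 0 = 0. Proof. by []. Qed.

Let Qfact : sexp Alo * sexp Ahi = Q.
Proof.
rewrite sexpD //; symmetry; apply: euler_sexp_inv; rewrite ?AQ //.
by rewrite scoefD /= addr0.
Qed.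

Let inv_exp (A : series R) : scoef A 0 = 0 -> sexp (- A) * sexp A = 1.
Proof.
move=> h; rewrite sexpD ?scoefN ?h ?oppr0 // addNr; symmetry.
apply: euler_sexp_inv => //; rewrite mul0r; apply: seriesP => -[|n] //=.
by rewrite mul0rn.
Qed.

Let hihyp n : low_zero (a * n.+1).+1 (scoef Ahi n.+1).
Proof. by move=> j jl; rewrite /= coefN coefMXn jl oppr0. Qed.
Let hihypN n : low_zero (a * n.+1).+1 (scoef (- Ahi) n.+1).
Proof. by move=> j jl; rewrite scoefN coefN hihyp ?oppr0. Qed.
Let lohyp n : (size (scoef Alo n.+1) <= a * n.+1)%N.
Proof.
rewrite /= size_polyN; apply/leq_sizeP => j jl.
rewrite coef_take_poly; case: ltnP => // jl2.
have -> : j = (a * n.+1)%N by lia.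
by rewrite cst.
Qed.
Let lohypN n : (size (scoef (- Alo) n.+1) <= a * n.+1)%N.
Proof. by rewrite scoefN size_polyN. Qed.

(** Q is the product of the exponentials of its negative and positive parts, and each
factor is also Q times the inverse of the other.  The first description bounds the
exponents of T on one side, the second on the other side, so both factors are
polynomials in T over K[[z]]: the coefficient of z^m is w m (after multiplication
by T^a) in one of them, and v m in the other. *)
Lemma wiener_hopf : exists w v : nat -> R,
  [/\ w 0 = 'X^a, v 0 = 1,
      forall m, (size (w m.+1) <= a)%N,
      forall m, (size (v m) <= b.+1)%N &
      (forall m, (v m.+1)`_0 = 0) /\
      (forall m, \sum_(i < m.+1) v i * w (m - i)%N =
        if m == 0 then 'X^a else if m == 1 then - p else 0)].
Proof.
have [hi1 hi2] := sexp_low hihyp.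
have [lo1 lo2] := size_sexp lohyp.
have [hi1N hi2N] := sexp_low hihypN.
have [lo1N lo2N] := size_sexp lohypN.
have hiE : sexp Ahi = sexp (- Alo) * Q.
  by rewrite -Qfact mulrA inv_exp // mul1r.
have loE : sexp Alo = sexp (- Ahi) * Q.
  by rewrite -Qfact [sexp Alo * _]mulrC mulrA inv_exp // mul1r.
pose v m := drop_poly (a * m) (scoef (sexp Ahi) m).
pose w m := if m is n.+1 then drop_poly (a * n) (scoef (sexp Alo) m) else 'X^a.
have vE m : v m * 'X^(a * m) = scoef (sexp Ahi) m by rewrite low_zero_drop.
have wE m : w m * 'X^(a * m) = scoef (sexp Alo) m * 'X^a.
  case: m => [|n]; first by rewrite muln0 mulr1 mul1r.
  rewrite mulnS addnC exprD mulrA low_zero_drop // loE MQ => j jl.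
  rewrite coefB (hi1N n.+1) ?sub0r; last by nia.
  have := @low_zeroM _ (a * n) 0 _ p (hi1N n); rewrite addn0 => h.
  by rewrite h // oppr0.
exists w, v; split=> // [|m|m|].
- by rewrite /v muln0 drop_poly0l.
- rewrite size_drop_poly; have := lo2 m; lia.
- rewrite size_drop_poly leq_subLR; case: m => [|m].
    by rewrite sexp0 size_poly1; lia.
  rewrite hiE MQ; apply: leq_trans (size_polyD _ _) _; rewrite geq_max size_polyN.
  apply/andP; split; first by apply: leq_trans (lo1N m.+1) _; lia.
  apply: leq_trans (size_polyMleq _ _) _; rewrite mulnS.
  by move: (lo1N m) szp; set x := size _; set y := size p; lia.
split=> m; first by rewrite /v coef_drop_poly add0n hi2.
have Xa0 : 'X^(a * m) != 0 :> R by rewrite monic_neq0 ?monicXn.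
apply: (mulIf Xa0); rewrite mulr_suml.
have -> : (if m == 0 then 'X^a else if m == 1 then - p else 0) * 'X^(a * m) =
   scoef (sexp Alo * sexp Ahi) m * 'X^a.
  rewrite Qfact /=; case: m {Xa0} => [|[|m]] /=; last by rewrite !mul0r.
    by rewrite muln0 mul1r mulr1.
  by rewrite muln1.
rewrite mulrC [sexp Alo * _]mulrC scoefM mulr_sumr; apply: eq_bigr => i _.
have im : (i <= m)%N by rewrite -ltnS.
have -> : 'X^(a * m) = 'X^(a * i) * 'X^(a * (m - i)) :> R.
  by rewrite -exprD -mulnDr subnKC.
rewrite mulrACA vE wE; ring.
Qed.

End WienerHopf.

(** * Field extensions with a linear retraction *)

(** Only the consequences of finiteness that matter are recorded: linear equations that
are solvable over k' are solvable over k, by applying the retraction to a solution. *)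
Record extension (k k' : fieldType) := Extension {
  ext_inj : {rmorphism k -> k'};
  ext_ret : {additive k' -> k};
  ext_retM : forall c d, ext_ret (ext_inj c * d) = c * ext_ret d;
  ext_ret1 : ext_ret 1 = 1 }.

Definition ext_id (k : fieldType) : extension k k.
Proof. by exists (idfun : {rmorphism k -> k}) (idfun : {additive k -> k}). Defined.

Definition ext_comp (k k1 k2 : fieldType) (e : extension k k1) (f : extension k1 k2) : extension k k2.
Proof.
exists (ext_inj f \o ext_inj e : {rmorphism k -> k2}) (ext_ret e \o ext_ret f : {additive k2 -> k}).
  by move=> c d /=; rewrite !ext_retM.
by rewrite /= !ext_ret1.
Defined.

Lemma irreducible_factor (k : fieldType) (p : {poly k}) : (1 < size p)%N ->
  exists2 q, irreducible_poly q & q %| p.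
Proof.
elim: {p}(size p) {-2}p (leqnn (size p)) => [p|n IH p sp p1].
  by rewrite leqn0 => /eqP ->.
have [irr|nirr] := boolp.pselect (irreducible_poly p); first by exists p.
have [q [sq qp qneq]] : exists q : {poly k}, [/\ size q != 1%N, q %| p & ~~ (q %= p)].
  apply: boolp.contrapT => h; apply: nirr; split=> // q sq qp.
  by apply/negPn/negP => hq; apply: h; exists q.
have p0 : p != 0 by rewrite -size_poly_gt0 ltnW.
have q0 : q != 0 by apply: contraTneq qp => ->; rewrite dvd0p.
have sq1 : (1 < size q)%N by rewrite ltn_neqAle eq_sym sq size_poly_gt0.
have : (size q < size p)%N.
  by rewrite ltn_neqAle dvdp_leq // andbT dvdp_size_eqp.
move=> lt; have [|r ir rq] := IH q _ sq1; first by lia.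
by exists r => //; apply: dvdp_trans qp.
Qed.

(** The retraction is a coordinate function that does not vanish at 1, rescaled. *)
Lemma ext_root (k : fieldType) (p : {poly k}) : (1 < size p)%N ->
  exists (k' : fieldType) (e : extension k k') (z : k'), root (map_poly (ext_inj e) p) z.
Proof.
move=> /irreducible_factor[q iq qp].
have [L _ [z rz _]] := irredp_FAdjoin iq.
pose b := vbasis {:L}.
have [i ci] : exists i, coord b i 1 != 0.
  apply/existsP; apply: contraT; rewrite negb_exists => /forallP h.
  have := coord_vbasis (memvf (1 : L)); rewrite big1 => [/eqP|i _].
    by rewrite oner_eq0.
  by move: (h i); rewrite negbK => /eqP ->; rewrite scale0r.
have zm : zmod_morphism (fun v : L => coord b i v / coord b i 1).
  by move=> u v; rewrite linearB /= mulrBl.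
pose phi := GRing.isZmodMorphism.Build _ _ _ zm.
pose r : {additive L -> k} := HB.pack (fun v : L => coord b i v / coord b i 1) phi.
have h1 (c : k) (d : L) : r (in_alg L c * d) = c * r d.
  by rewrite /= -scalerAl mul1r linearZ /= mulrA.
have h2 : r 1 = 1 by rewrite /= divff.
exists L, (Extension h1 h2), z => /=.
by move: rz; rewrite -!dvdp_XsubCl => /dvdp_trans; apply; rewrite dvdp_map.
Qed.

Lemma ext_split (k : fieldType) (p : {poly k}) : p != 0 ->
  exists (k' : fieldType) (e : extension k k') (rs : seq k'),
   map_poly (ext_inj e) p = ext_inj e (lead_coef p) *: \prod_(r <- rs) ('X - r%:P).
Proof.
move: (leqnn (size p)); move: {2}(size p) => n.
elim: n k p => [k p|n IH k p sp p0].
  by rewrite leqn0 size_poly_eq0 => /eqP ->; rewrite eqxx.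
have [s1|s1] := leqP (size p) 1.
  exists k, (ext_id k), [::]; rewrite big_nil /= alg_polyC.
  by rewrite map_poly_id // lead_coefE {1}(size1_polyC s1) (eqP (_ : (size p).-1 == 0%N)) // -subn1 subn_eq0.
have [k1 [e [z rz]]] := ext_root s1.
have /factor_theorem[q Eq] := rz.
have sq : size (map_poly (ext_inj e) p) = (size q).+1.
  rewrite Eq size_Mmonic ?monicXsubC ?size_XsubC ?addn2 //.
  by apply: contraNneq p0 => q0; move: Eq; rewrite q0 mul0r => /eqP; rewrite map_poly_eq0.
have q0 : q != 0.
  by move: s1; rewrite -(size_map_poly (ext_inj e)) sq ltnS size_poly_gt0.
have [|k2 [f [rs Ers]]] := IH k1 q _ q0.
  by move: sp; rewrite -(size_map_poly (ext_inj e)) sq ltnS.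
exists k2, (ext_comp e f), (ext_inj f z :: rs).
rewrite /= map_poly_comp Eq rmorphM /= Ers big_cons map_polyXsubC.
have -> : lead_coef q = ext_inj e (lead_coef p).
  rewrite -(lead_coef_map (ext_inj e)) Eq lead_coefM lead_coefXsubC mulr1 //.
by rewrite -scalerAl mulrC.
Qed.

Lemma ext_char0 (k k' : fieldType) (e : {rmorphism k -> k'}) :
  (forall n, (n.+1)%:R != 0 :> k) -> (forall n, (n.+1)%:R != 0 :> k').
Proof. by move=> h n; rewrite -(rmorph_nat e) fmorph_eq0. Qed.

(** * The one-variable theorem of Duistermaat and van der Kallen *)

Section SeriesConst.
Variable K : comNzRingType.

Definition sconst (c : K) : series K := Series (fun n => if n == 0%N then c else 0).
Fact sconst_zmod : zmod_morphism sconst.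
Proof. by move=> c d; apply: seriesP => -[|n] //=; rewrite subr0. Qed.
HB.instance Definition _ := GRing.isZmodMorphism.Build K (series K) sconst sconst_zmod.

Lemma sconstM c s n : scoef (sconst c * s) n = c * scoef s n.
Proof.
rewrite scoefM big_ord_recl /= subn0 big1 ?addr0 // => i _.
by rewrite mul0r.
Qed.
Fact sconst_monoid : monoid_morphism sconst.
Proof.
split=> [|c d]; apply: seriesP => n; first by rewrite scoef1 /=; case: eqP.
by rewrite sconstM /=; case: eqP => //; rewrite mulr0.
Qed.
HB.instance Definition _ := GRing.isMonoidMorphism.Build K (series K) sconst sconst_monoid.

Definition svar : series K := Series (fun n => (n == 1)%:R).
Lemma svarM s n : scoef (svar * s) n = if n is m.+1 then scoef s m else 0.
Proof.
case: n => [|n]; first by rewrite scoefM big_ord1 mul0r.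
rewrite scoefM 2!big_ord_recl /= mul0r add0r mul1r subSS subn0 big1 ?addr0 // => i _.
by rewrite mul0r.
Qed.
Lemma svarX k n : scoef (svar ^+ k) n = (n == k)%:R.
Proof.
elim: k n => [|k IH] [|n]; rewrite ?scoef1 // exprS svarM //.
Qed.

(** Exchanges the roles of the two variables: a sequence of polynomials in T of bounded
degree, read as a series in z, becomes a polynomial in T over the series in z. *)
Definition poly_of_seq (N : nat) (f : nat -> {poly K}) : {poly series K} :=
  \poly_(i < N) Series (fun m => (f m)`_i).
Lemma coef_poly_of_seq N (f : nat -> {poly K}) : (forall m, (size (f m) <= N)%N) ->
  forall i m, scoef (poly_of_seq N f)`_i m = (f m)`_i.
Proof.
move=> h i m; rewrite coef_poly; case: ltnP => //= iN.
by rewrite nth_default // (leq_trans (h m)).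
Qed.
Lemma poly_of_seqM N M (f g : nat -> {poly K}) :
  (forall m, (size (f m) <= N)%N) -> (forall m, (size (g m) <= M)%N) ->
  forall i m, scoef (poly_of_seq N f * poly_of_seq M g)`_i m =
    (\sum_(l < m.+1) f l * g (m - l)%N)`_i.
Proof.
move=> hf hg i m; rewrite coefM scoef_sum coef_sum.
under eq_bigr => j _ do rewrite scoefM.
under [RHS]eq_bigr => j _ do rewrite coefM.
rewrite exchange_big; apply: eq_bigr => j _; apply: eq_bigr => l _.
by rewrite !coef_poly_of_seq.
Qed.
End SeriesConst.

Lemma integral_prod (R K : comNzRingType) (f : {rmorphism R -> K}) (rs : seq K) :
  (forall r, r \in rs -> integralOver f r) -> integralOver f (\prod_(r <- rs) r).
Proof.
move=> h; rewrite big_seq; apply: big_ind => //; first exact: integral1.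
by move=> x y; apply: integral_mul.
Qed.

Lemma exprVB (F : fieldType) (x : F) i d : x != 0 -> (i <= d)%N ->
  x^-1 ^+ i * x ^+ d = x ^+ (d - i).
Proof.
move=> x0 id; rewrite -[in LHS](subnKC id) exprD mulrA exprVn mulVf ?mul1r //.
exact: expf_neq0.
Qed.

Section SvarNotIntegral.
Variables (K L : fieldType) (iota : {rmorphism series K -> L}).
Hypothesis iota0 : forall s, iota s = 0 -> s = 0.
Let z : series K := svar K.
Let zeta := iota z.
Let ic : {rmorphism K -> L} := iota \o @sconst K.

Lemma iota_svar_neq0 : zeta != 0.
Proof.
apply/eqP => /iota0 /(congr1 (fun s => scoef s 1%N)) /= /eqP.
by rewrite oner_eq0.
Qed.

Fact eval_svarV_comm : commr_rmorph ic zeta^-1.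
Proof. by move=> x; apply: mulrC. Qed.

(** Evaluation of polynomials at z^-1.  Integrality over K[z^-1] is integrality with
respect to this map. *)
Definition eval_svarV : {rmorphism {poly K} -> L} := horner_morph eval_svarV_comm.

Lemma eval_svarVC c : eval_svarV c%:P = iota (sconst c).
Proof. by rewrite /= horner_morphC. Qed.

Lemma eval_svarVX : eval_svarV 'X = zeta^-1.
Proof. by rewrite /= horner_morphX. Qed.

(** Dividing a monic equation of degree d for z by z^d gives 1 + z^-1 (...) = 0, a
polynomial in z^-1 with constant term 1, whereas z^-1 is transcendental over K. *)
Lemma svar_not_integral : ~ integralOver eval_svarV zeta.
Proof.
have zeta0 := iota_svar_neq0.
case=> q mq rq.
have [d sq] : exists d, size q = d.+1.
  by exists (size q).-1; rewrite prednK // size_poly_gt0 monic_neq0.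
(* T is q divided by zeta^d, written in zeta^-1. *)
pose T : {poly K} := \sum_(i < d.+1) q`_i * 'X^(d - i).
have rT : eval_svarV T = 0.
  have zd0 : zeta ^+ d != 0 by rewrite expf_neq0.
  apply: (mulIf zd0); rewrite mul0r /T rmorph_sum mulr_suml.
  transitivity (map_poly eval_svarV q).[zeta]; last exact: (eqP rq).
  have sq' : (size (map_poly eval_svarV q) <= d.+1)%N by rewrite -sq size_poly.
  rewrite (horner_coef_wide _ sq'); apply: eq_bigr => i _.
  have E : eval_svarV (q`_i * 'X^(d - i)) = eval_svarV q`_i * zeta^-1 ^+ (d - i).
    by rewrite rmorphM rmorphXn eval_svarVX.
  rewrite E coef_map -mulrA.
  congr (_ * _); have id : (i <= d)%N by rewrite -ltnS.
  by rewrite exprVB ?leq_subr // subKn.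
have T0 : T`_0 = 1.
  rewrite coef_sum big_ord_recr /= subnn mulr1 big1 ?add0r.
    move: (monicP mq); rewrite lead_coefE sq /= => ->; by rewrite coef1.
  by move=> i _; rewrite coefMXn subn_gt0 ltn_ord.
pose N := size T.
have : \sum_(j < N) sconst T`_j * z ^+ (N - j) = 0.
  apply: iota0; have zd0 : zeta ^+ N != 0 by rewrite expf_neq0.
  transitivity (eval_svarV T * zeta ^+ N); last by rewrite rT mul0r.
  rewrite rmorph_sum; have -> : eval_svarV T = (map_poly ic T).[zeta^-1] by [].
  rewrite (@horner_coef_wide _ N _ _ (size_poly _ _)).
  rewrite mulr_suml; apply: eq_bigr => i _.
  have E : iota (sconst T`_i * z ^+ (N - i)) = ic T`_i * zeta ^+ (N - i).
    by rewrite rmorphM rmorphXn.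
  by rewrite coef_map -mulrA exprVB ?(ltnW (ltn_ord i)) //; exact: E.
move/(congr1 (fun s => scoef s N)); rewrite scoef_sum scoef0.
have N0 : (0 < N)%N.
  by rewrite size_poly_gt0; apply: contra_eq_neq T0 => ->; rewrite coef0 eq_sym oner_eq0.
have [n En] : exists n, N = n.+1 by exists N.-1; rewrite prednK.
rewrite En big_ord_recl sconstM svarX subn0 eqxx T0 mulr1 big1 ?addr0.
  by move=> /eqP; rewrite oner_eq0.
move=> i _; rewrite sconstM svarX lift0.
have -> : (n.+1 == n.+1 - i.+1)%N = false by apply/eqP; lia.
by rewrite mulr0.
Qed.

End SvarNotIntegral.

Section DvdK.
Variable K : fieldType.
Hypothesis char0 : forall n, (n.+1)%:R != 0 :> K.

(** The constant coefficient of W comes from setting T = 0 in T^a - z p = W V, since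
V(0) = 1. *)
Lemma series_factorization (p : {poly K}) (a b : nat) : (0 < a)%N ->
  (size p <= (a + b).+1)%N ->
  (forall m, (0 < m)%N -> (p ^+ m)`_(a * m) = 0) ->
  exists W V : {poly series K}, [/\ size W = a.+1, W`_a = 1,
    W`_0 = - (sconst p`_0 * svar K) &
    V * W = 'X^a - svar K *: map_poly (@sconst K) p].
Proof.
move=> a0 szp cst.
have [w [v [w0 v0 sw sv [v1 wv]]]] := wiener_hopf char0 szp cst.
have sw' m : (size (w m) <= a.+1)%N.
  case: m => [|m]; first by rewrite w0 size_polyXn.
  exact: leq_trans (leqnSn _).
pose W := poly_of_seq a.+1 w; pose V := poly_of_seq b.+1 v.
pose z : series K := svar K.
have VW : V * W = 'X^a - z *: map_poly (@sconst K) p.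
  apply/polyP => i; apply: seriesP => m.
  rewrite poly_of_seqM // wv coefB coefZ coef_map coefXn scoefD scoefN svarM /=.
  case: m => [|[|m]] /=; rewrite ?subr0 ?coefXn ?coefN ?coef0.
  - by case: (i == a).
  - by case: (i == a); rewrite /= ?sub0r.
  - by case: (i == a); rewrite /= ?sub0r ?subr0.
have Wa : W`_a = 1.
  apply: seriesP => -[|m]; rewrite coef_poly_of_seq // scoef1.
    by rewrite w0 coefXn eqxx.
  by rewrite nth_default.
have W_0 : W`_0 = - (sconst p`_0 * z).
  apply: seriesP => m; rewrite coef_poly_of_seq // scoefN sconstM /=.
  have := congr1 (fun q : {poly K} => q`_0) (wv m).
  rewrite coef_sum big_ord_recl v0 mul1r subn0 big1 ?addr0.
    move=> ->; case: m => [|[|m]] /=; rewrite ?mulr0 ?mulr1 ?oppr0 ?coef0 ?coefN //.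
    by rewrite coefXn eq_sym eqn0Ngt a0.
  by move=> i _; rewrite lift0 coef0M v1 mul0r.
have sW : size W = a.+1.
  apply/eqP; rewrite eqn_leq size_poly ltnNge; apply/negP => h.
  have : W`_a = 0 by rewrite nth_default.
  by rewrite Wa => /eqP; rewrite oner_eq0.
by exists W, V.
Qed.

(** Over a splitting field of W, a root r satisfies p(r) = z^-1 r^a.  This equation is
monic up to a constant because deg p > a, so r is integral over K[z^-1]. *)
Lemma dvdk_two_sided (p : {poly K}) (a b : nat) : (0 < a)%N -> (0 < b)%N ->
  size p = (a + b).+1 -> p`_0 != 0 ->
  (forall m, (0 < m)%N -> (p ^+ m)`_(a * m) = 0) -> False.
Proof.
move=> a0 b0 sp p0 cst.
have szp : (size p <= (a + b).+1)%N by rewrite sp.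
have [W [V [sW Wa W_0 VW]]] := series_factorization a0 szp cst.
pose z : series K := svar K.
pose F : fieldType := {fraction (series K)}.
pose W' : {poly F} := map_poly (@tofrac (series K)) W.
have W'0 : W' != 0.
  apply/eqP => /(congr1 (fun q : {poly F} => q`_a)) /eqP.
  by rewrite coef_map Wa /= tofrac1 coef0 oner_eq0.
have [L [e [rs]]] := ext_split W'0.
pose iota : {rmorphism series K -> L} := (ext_inj e \o @tofrac (series K)).
rewrite -map_poly_comp /= -/iota.
have -> : lead_coef W' = 1.
  rewrite lead_coefE; have -> : size W' = a.+1.
    rewrite size_map_inj_poly ?tofrac0 //.
    by move=> x y /eqP; rewrite tofrac_eq => /eqP.
  by rewrite coef_map Wa /= tofrac1.
rewrite rmorph1 scale1r => splitW.
have iota0 s : iota s = 0 -> s = 0.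
  by move=> /eqP; rewrite /= fmorph_eq0 tofrac_eq0 => /eqP.
pose zeta := iota z.
have zeta0 : zeta != 0 := iota_svar_neq0 iota0.
pose ic : {rmorphism K -> L} := iota \o @sconst K.
pose rho := eval_svarV iota.
have rhoC c : rho c%:P = ic c := eval_svarVC iota c.
have rhoX : rho 'X = zeta^-1 := eval_svarVX iota.
pose lc := lead_coef p.
have lc0 : lc != 0 by rewrite lead_coef_eq0 -size_poly_gt0 sp.
have rint r : r \in rs -> integralOver rho r.
  move=> rrs; have rW : root (map_poly iota W) r by rewrite splitW root_prod_XsubC.
  have rVW : root (map_poly iota (V * W)) r.
    by rewrite rmorphM rootM rW orbT.
  (* The variable of the inner polynomials stands for z^-1: g1 - g2 is the monic
     multiple of p - z^-1 T^a. *)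
  pose g1 : {poly {poly K}} := map_poly polyC (lc^-1 *: p).
  pose g2 : {poly {poly K}} := (lc^-1 *: 'X) *: 'X^a.
  have sg1 : size g1 = (a + b).+1.
    by rewrite size_map_polyC size_scale ?invr_eq0.
  have sg2 : (size g2 < size g1)%N.
    rewrite sg1; apply: leq_ltn_trans (size_scale_leq _ _) _.
    by rewrite size_polyXn; lia.
  exists (g1 - g2).
    rewrite monicE lead_coefDl ?size_polyN // lead_coef_map_inj //; last exact: polyC_inj.
    by rewrite lead_coefZ mulVf.
  rewrite rootE rmorphB /= hornerD hornerN.
  have -> : map_poly rho g1 = ic lc^-1 *: map_poly ic p.
    by rewrite -map_polyZ -map_poly_comp; apply: eq_map_poly => c; rewrite /= horner_morphC.
  have -> : (map_poly rho g2) = (ic lc^-1 * zeta^-1) *: 'X^a.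
    have E : rho (lc^-1 *: 'X) = ic lc^-1 * zeta^-1.
      by rewrite -mul_polyC rmorphM rhoC rhoX.
    by rewrite map_polyZ map_polyXn E.
  move: rVW; rewrite VW rmorphB /= map_polyXn map_polyZ -map_poly_comp rootE.
  rewrite !hornerE subr_eq0 => /eqP ->.
  by rewrite -/zeta -[X in _ - X]mulrA mulKf // subrr.
have zint0 : integralOver rho (\prod_(r <- rs) r).
  exact: integral_prod.
have prodE : \prod_(r <- rs) (- r) = - (ic p`_0 * zeta).
  have := congr1 (fun q => q.[0]) splitW; rewrite horner_prod.
  under eq_bigr => r _ do rewrite hornerXsubC sub0r.
  have E : iota (- (sconst p`_0 * z)) = - (ic p`_0 * zeta).
    by rewrite rmorphN rmorphM.
  by move=> <-; rewrite horner_coef0 coef_map W_0; apply: E.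
apply: (svar_not_integral iota0).
have -> : iota (svar K) = rho (- ((p`_0)^-1 * (-1) ^+ size rs))%:P * \prod_(r <- rs) r.
  rewrite rhoC; have : \prod_(r <- rs) - r = (-1) ^+ size rs * \prod_(r <- rs) r.
    elim: rs {splitW rint zint0 prodE} => [|r rs IH]; first by rewrite !big_nil mulr1.
    by rewrite !big_cons IH /= exprS; ring.
  have E : ic (- ((p`_0)^-1 * (-1) ^+ size rs)) = - ((ic p`_0)^-1 * (-1) ^+ size rs).
    by rewrite rmorphN rmorphM rmorphXn rmorphN1 fmorphV.
  rewrite prodE E => h; rewrite mulNr -mulrA -h mulrN opprK mulKf //.
  by rewrite fmorph_eq0.
by apply: integral_mul => //; apply: integral_id.
Qed.

(** In terms of f = T^-a p: if no power of f has a constant term, then f has only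
positive or only negative exponents.  Removing powers of 'X from p reduces to
[dvdk_two_sided], except when an extreme exponent of f is 0; then the constant term
of f itself is an extreme coefficient of p. *)
Lemma dvdk (p : {poly K}) (a : nat) :
  (forall m, (0 < m)%N -> (p ^+ m)`_(a * m) = 0) ->
  (forall i, (i <= a)%N -> p`_i = 0) \/ (size p <= a)%N.
Proof.
have [s1|s1] := leqP (size p) a; first by right.
move=> H; left.
have [[e]|h] := boolp.pselect (exists e, (e <= a)%N && (p`_e != 0)); last first.
  by move=> i ia; apply/eqP/negPn/negP => pi; apply: h; exists i; rewrite ia pi.
move=> he; have exe : exists e, (e <= a)%N && (p`_e != 0) by exists e.
case: (ex_minnP exe) => {he exe}{}e /andP[ea pe] emin.
(* e is the order of p at 0. *)
have lowp : low_zero e p.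
  move=> j je; apply/eqP/negPn/negP => pj.
  have := emin j; rewrite pj (leq_trans (ltnW je) ea) leqNgt je => /(_ isT).
  by [].
pose q := drop_poly e p; pose c := (a - e)%N.
have Ep : p = q * 'X^e by rewrite low_zero_drop.
have Ea : a = (c + e)%N by rewrite subnK.
have hq m : (0 < m)%N -> (q ^+ m)`_(c * m) = 0.
  move=> m0; have := H m m0.
  rewrite Ep exprMn -exprM coefMXn Ea mulnDl ltnNge leq_addl /=.
  by rewrite addnK.
have q0 : q`_0 != 0 by rewrite coef_drop_poly.
have sq : size q = (size p - e)%N by rewrite size_drop_poly.
exfalso; have [c0|c0] := posnP c.
  by have := hq 1 isT; rewrite c0 mul0n expr1; apply/eqP.
have [s2|s2] := leqP (size p) a.+1.
  have := hq 1 isT; rewrite muln1 expr1; have -> : c = (size q).-1 by lia.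
  by apply/eqP; rewrite -lead_coefE lead_coef_eq0 -size_poly_gt0; lia.
by apply: (@dvdk_two_sided q c (size p - a.+1) c0 _ _ q0 hq); lia.
Qed.

End DvdK.

(** * Algebraic dependence in the polynomial plane *)

Lemma lin_dep (k : fieldType) (I J : finType) (c : I -> J -> k) : (#|J| < #|I|)%N ->
  exists2 al : I -> k, exists i, al i != 0 & forall j, \sum_i al i * c i j = 0.
Proof.
move=> JI; pose M : 'M[k]_(#|I|, #|J|) := \matrix_(i, j) c (enum_val i) (enum_val j).
have : kermx M != 0.
  rewrite kermx_eq0 /row_free; apply/eqP => rM.
  by move: (rank_leq_col M); rewrite rM leqNgt JI.
move=> /rowV0Pn[v /sub_kermxP vM v0].
exists (fun i => v 0 (enum_rank i)).
  have [i vi] : exists i, v 0 i != 0.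
    apply/existsP; apply: contraNT v0; rewrite negb_exists => /forallP h.
    by apply/eqP/rowP => i; rewrite mxE; move: (h i); rewrite negbK => /eqP.
  by exists (enum_val i); rewrite enum_valK.
move=> j; have := congr1 (fun A : 'rV_ _ => A 0 (enum_rank j)) vM.
rewrite !mxE (reindex (@enum_rank I)) /=; last first.
  by exists enum_val => x _; rewrite ?enum_rankK ?enum_valK.
by move=> E; rewrite -[RHS]E; apply: eq_bigr => i _; rewrite mxE !enum_rankK.
Qed.

Section Plane.
Variable k : fieldType.
Notation A := {mpoly k[2]}.
Implicit Types u v w : A.

(** One fixed degree function, equal to the total degree plus 1 on nonzero polynomials. *)
Definition deg1 u : nat := msize u.
Lemma deg1_eq0 u : (deg1 u == 0%N) = (u == 0).
Proof. exact: msize_poly_eq0. Qed.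
Lemma deg1_gt0 u : (0 < deg1 u)%N = (u != 0).
Proof. by rewrite lt0n deg1_eq0. Qed.
Lemma deg1M u v : u != 0 -> v != 0 -> deg1 (u * v) = (deg1 u + deg1 v).-1.
Proof. exact: msizeM. Qed.
Lemma deg1_0 : deg1 0 = 0%N.
Proof. exact: msize0. Qed.
Lemma deg1_1 : deg1 1 = 1%N.
Proof. exact: msize1. Qed.
Lemma deg1C c : deg1 c%:MP = (c != 0).
Proof. exact: msizeC. Qed.
Lemma deg1_constP u : (deg1 u <= 1)%N -> u = (u@_0)%:MP.
Proof. exact: msize1_polyC. Qed.

Lemma const_factor u v : u * v != 0 -> (deg1 (u * v) <= 1)%N -> (deg1 u <= 1)%N.
Proof.
rewrite mulf_eq0 negb_or => /andP[u0 v0]; rewrite deg1M //.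
have : (0 < deg1 v)%N by rewrite lt0n deg1_eq0.
lia.
Qed.

(** A nonconstant u is not a unit.  An equation for u of minimal degree has a nonzero
constant term, and such an equation would exhibit an inverse of u. *)
Lemma algebraic_const u (P : {poly k}) : P != 0 ->
  \sum_(i < size P) P`_i *: u ^+ i = 0 -> (deg1 u <= 1)%N.
Proof.
move=> P0; have [//|u1] := leqP (deg1 u) 1.
have u0 : u != 0 by rewrite -deg1_eq0 -lt0n ltnW.
move: (leqnn (size P)); move: {2}(size P) => n.
elim: n P P0 => [P P0|n IH P P0 sP].
  by rewrite leqn0 size_poly_eq0 (negPf P0).
have sP0 : (0 < size P)%N by rewrite size_poly_gt0.
move=> h; pose q := drop_poly 1 P.
have EP : P = q * 'X + (P`_0)%:P.
  rewrite -{1}(poly_take_drop 1 P) expr1 addrC; congr (_ + _).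
  by apply/polyP => -[|i]; rewrite coef_take_poly coefC //.
have sq : size P = (size q).+1 by rewrite size_drop_poly; lia.
have hq : u * \sum_(i < size q) q`_i *: u ^+ i = - (P`_0)%:MP.
  move: h; rewrite sq big_ord_recl expr0 => /eqP; rewrite addrC addr_eq0 => /eqP.
  rewrite -mul_mpolyC mulr1 => <-; rewrite mulr_sumr; apply: eq_bigr => i _.
  by rewrite lift0 -scalerAr -exprS coef_drop_poly addn1.
have [P00|P00] := eqVneq P`_0 0.
  apply: (IH q).
  - by apply: contra_neq P0 => q0; rewrite EP q0 P00 mul0r add0r.
  - by rewrite -ltnS -sq.
  by apply: (mulfI u0); rewrite hq P00 mpolyC0 oppr0 mulr0.
have := @const_factor u (\sum_(i < size q) q`_i *: u ^+ i).
rewrite hq -mpolyCN mpolyC_eq0 oppr_eq0 P00 => /(_ isT); rewrite deg1C oppr_eq0 P00.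
by move=> /(_ isT); rewrite leqNgt u1.
Qed.

Lemma deg1X_le u n d : (deg1 u <= d.+1)%N -> (deg1 (u ^+ n) <= (d * n).+1)%N.
Proof.
move=> ud; elim: n => [|n IH]; first by rewrite expr0 deg1_1.
have [u0|u0] := eqVneq u 0; first by rewrite u0 expr0n /= deg1_0.
rewrite exprS deg1M ?expf_neq0 //; nia.
Qed.

Lemma deg1M_le u v a b : (deg1 u <= a.+1)%N -> (deg1 v <= b.+1)%N ->
  (deg1 (u * v) <= (a + b).+1)%N.
Proof.
have [->|u0] := eqVneq u 0; first by rewrite mul0r deg1_0.
have [->|v0] := eqVneq v 0; first by rewrite mulr0 deg1_0.
by rewrite deg1M //; lia.
Qed.

(** Counting: the N^3 monomials in u, v, w with exponents below N have degree at most
3Nd, so they live in a space of dimension of order N^2. *)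
Lemma algebraic_dependence3 u v w : exists (N : nat) (al : nat -> nat -> nat -> k),
  (exists i j l, [/\ (i < N)%N, (j < N)%N, (l < N)%N & al i j l != 0]) /\
  \sum_(i < N) \sum_(j < N) \sum_(l < N) al i j l *: (u ^+ i * v ^+ j * w ^+ l) = 0.
Proof.
(* M^2 is at most (3 d + 1)^2 N^2, which is below N^3. *)
pose d := (deg1 u + deg1 v + deg1 w)%N.
pose N := ((3 * d + 1) ^ 2 + 1)%N.
pose M := (3 * N * d + 1)%N.
pose F (x : 'I_N * 'I_N * 'I_N) := u ^+ x.1.1 * v ^+ x.1.2 * w ^+ x.2.
pose mn (y : 'I_M * 'I_M) : 'X_{1..2} := [multinom (if (i : nat) == 0%N then y.1 : nat else y.2) | i < 2].
have [|al [i ai] H] := @lin_dep k _ _ (fun x y => (F x)@_(mn y)).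
  rewrite !card_prod !card_ord /M /N; nia.
exists N, (fun i j l => if (insub i, insub j, insub l) is (Some i', Some j', Some l')
   then al (i', j', l') else 0); split.
  exists i.1.1, i.1.2, i.2; rewrite !ltn_ord; split=> //.
  by rewrite !valK; move: ai; case: i => -[].
transitivity (\sum_x al x *: F x).
  rewrite pair_big pair_big /=; apply: eq_bigr => -[[i' j'] l'] _ /=.
  by rewrite !valK.
apply/mpolyP => m; rewrite mcoeff0 raddf_sum /=.
under eq_bigr => x _ do rewrite mcoeffZ.
have [mM|Mm] := ltnP (mdeg m) M.
  have mi (i' : 'I_2) : (m i' < M)%N.
    by apply: leq_ltn_trans mM; rewrite mdegE (bigD1 i') //= leq_addr.
  rewrite -[RHS](H (Ordinal (mi ord0), Ordinal (mi ord_max))); apply: eq_bigr => x _.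
  congr (_ * _@_ _); apply/mnmP => -[[|[|//]] p]; rewrite mnmE /=; congr (m _); exact: val_inj.
rewrite big1 // => x _; rewrite [X in _ * X]memN_msupp_eq0 ?mulr0 //.
apply: msize_mdeg_ge; apply: leq_trans Mm.
have hu : (deg1 u <= d.+1)%N by lia.
have hv : (deg1 v <= d.+1)%N by lia.
have hw : (deg1 w <= d.+1)%N by lia.
have var_pp := deg1M_le (deg1M_le (deg1X_le x.1.1 hu) (deg1X_le x.1.2 hv)) (deg1X_le x.2 hw).
apply: leq_trans var_pp _; have := ltn_ord x.1.1; have := ltn_ord x.1.2; have := ltn_ord x.2.
rewrite /M; nia.
Qed.
End Plane.

(** * Irreducible polynomials in two variables are prime *)

Definition divides (R : comNzRingType) (q a : R) : Prop := exists c, a = q * c.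

(** Units satisfy this; where it matters, they are excluded separately. *)
Definition irreducible (R : comUnitRingType) (q : R) : Prop :=
  forall u v, q = u * v -> u \is a GRing.unit \/ v \is a GRing.unit.

Section Gauss.
Variable k : fieldType.
Notation R := {poly k}.
Notation S := {poly {poly k}}.

Lemma divides_polyC (c : R) (a : S) : (forall i, c %| a`_i) -> divides c%:P a.
Proof.
move=> h; exists (map_poly (fun r => r %/ c) a); apply/polyP => i.
by rewrite coefCM coef_map_id0 ?div0p // mulrC divpK.
Qed.

(** The residue ring k[x]/c is a field, so it embeds in an extension of k, and
the polynomials in y over that extension form a domain. *)
Lemma gauss_prime (c : R) (a b : S) : irreducible_poly c ->
  divides c%:P (a * b) -> divides c%:P a \/ divides c%:P b.
Proof.
move=> ic [w E].
have [L [e [z rz]]] := ext_root ic.1.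
have cfu : commr_rmorph (ext_inj e) z by move=> x; apply: mulrC.
pose g : {rmorphism R -> L} := horner_morph cfu.
have gc : g c = 0 by apply/eqP.
have g0 r : g r = 0 -> c %| r.
  move=> gr; have [//|ncr] := boolP (c %| r).
  have cop : coprimep c r.
    rewrite /coprimep; apply: contraNT ncr => s1.
    by have := ic.2 _ s1 (dvdp_gcdl c r) => /eqp_dvdl <-; apply: dvdp_gcdr.
  have /Bezout_eq1_coprimepP[[u v] /= uv] := cop.
  have := congr1 g uv; rewrite rmorphD !rmorphM gr gc !mulr0 addr0 rmorph1 => /eqP.
  by rewrite eq_sym oner_eq0.
have H : map_poly g a * map_poly g b = 0.
  transitivity ((g c)%:P * map_poly g w); last by rewrite gc mul0r.
  by rewrite -rmorphM E rmorphM /= map_polyC.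
have key (x : S) : map_poly g x = 0 -> divides c%:P x.
  move=> x0; apply: divides_polyC => i; apply: g0.
  by have := congr1 (fun q : {poly L} => q`_i) x0; rewrite coef_map coef0.
by move/eqP: H; rewrite mulf_eq0 => /orP[] /eqP /key; [left | right].
Qed.

(** Gauss's lemma: the prime factors of c can be distributed, one at a time, between
the two factors d and u. *)
Lemma gauss_split (c : R) (q d u : S) : c != 0 -> c%:P * q = d * u ->
  exists (c1 : R) (d' u' : S), [/\ c1 != 0, d = c1%:P * d' & q = d' * u'].
Proof.
move: (leqnn (size c)); move: {2}(size c) => n.
elim: n c d u => [|n IH] c d u sc c0 E.
  by move: sc; rewrite leqn0 size_poly_eq0 (negPf c0).
have [s1|s1] := leqP (size c) 1.
  move: E c0; rewrite (size1_polyC s1) polyC_eq0; set x := c`_0 => E x0.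
  exists 1, d, ((x^-1)%:P%:P * u); split; rewrite ?oner_eq0 ?mul1r //.
  by rewrite mulrCA -E mulrA -!polyCM mulVf // mul1r.
have [p ip pc] := irreducible_factor s1.
have p0 : p != 0 by apply: contraTneq pc => ->; rewrite dvd0p.
have Ec : c = p * (c %/ p) by rewrite mulrC divpK.
set c' := c %/ p in Ec.
have c'0 : c' != 0 by apply: contraNneq c0 => h; rewrite Ec h mulr0.
have sc' : (size c' <= n)%N.
  move: sc ip.1; rewrite Ec size_mul //; move: (size p) (size c') => x y; lia.
have pP0 : p%:P != 0 :> S by rewrite polyC_eq0.
have : divides p%:P (d * u) by exists (c'%:P * q); rewrite -E Ec polyCM mulrA.
case/(gauss_prime ip) => -[w Ew].
  have [|c1 [d' [u' [c10 Ed Eq]]]] := IH c' w u sc' c'0.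
    by apply: (mulfI pP0); rewrite mulrA -polyCM -Ec E Ew mulrA.
  exists (p * c1), d', u'; split=> //; first by rewrite mulf_neq0.
  by rewrite Ew Ed polyCM mulrA.
apply: (IH c' d w sc' c'0).
by apply: (mulfI pP0); rewrite mulrA -polyCM -Ec E Ew mulrCA.
Qed.

Lemma size_unit (d : S) : d \is a GRing.unit -> size d = 1%N.
Proof. by rewrite poly_unitE => /andP[/eqP]. Qed.

Lemma polyC_unit (c : R) : (c%:P : S) \is a GRing.unit -> c \is a GRing.unit.
Proof. by rewrite poly_unitE coefC => /andP[]. Qed.

(** An irreducible polynomial that involves y has no factor in k[x], so a scalar
in k[x] can be cancelled from a multiple of it. *)
Lemma irreducible_cancel (c : R) (q a w : S) : irreducible q -> (1 < size q)%N -> c != 0 ->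
  c%:P * a = q * w -> divides q a.
Proof.
move=> iq sq c0 /(gauss_split c0)[c1 [d' [u' [c10 Eq Ea]]]].
case: (iq _ _ Eq) => [uc|ud].
  exists ((c1%:P)^-1 * u'); rewrite Ea Eq; rewrite mulrA [c1%:P * d']mulrC.
  by rewrite -[d' * _ * _]mulrA mulrV // mulr1.
by move: sq; rewrite Eq size_Cmul // (size_unit ud).
Qed.

(** Over the field of fractions of k[x], a gcd d of q and a divides both and is a
combination of them; clearing denominators costs factors in k[x], which
[gauss_split] and [irreducible_cancel] remove.  As q is irreducible, d is, up to
a factor in k[x], either associated to q or a unit.  If q itself lies in k[x], this is
[gauss_prime]. *)
Lemma irreducible_prime_bivariate (q a b : S) : q != 0 -> irreducible q -> divides q (a * b) ->
  divides q a \/ divides q b.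
Proof.
move=> q0 iq [w Eab].
have [uq|nuq] := boolP (q \is a GRing.unit).
  by left; exists (q^-1 * a); rewrite mulrA mulrV // mul1r.
have [s1|s1] := leqP (size q) 1.
  move: q0 iq Eab nuq; rewrite (size1_polyC s1); set c := q`_0 => c0 iq Eab nuq.
  have c0' : c != 0 by move: c0; rewrite polyC_eq0.
  apply: (@gauss_prime c); last by exists w.
  split.
    rewrite ltnNge; apply: contra nuq => sc.
    rewrite poly_unitE size_polyC c0' coefC /= poly_unitE.
    have s1' : size c = 1%N by apply/eqP; rewrite eqn_leq sc size_poly_gt0.
    rewrite s1' eqxx unitfE /=; apply: contraNneq c0' => h.
    by rewrite (size1_polyC sc) h.
  move=> r sr rc; have Ec : c = (c %/ r) * r by rewrite divpK.
  have := iq (c %/ r)%:P r%:P; rewrite -polyCM -Ec => /(_ erefl) [] /polyC_unit.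
    rewrite poly_unitE => /andP[/eqP s _]; rewrite -dvdp_size_eqp //.
    have r0 : r != 0 by apply: contraNneq c0' => r0; rewrite Ec r0 mulr0.
    have d0 : c %/ r != 0 by rewrite -size_poly_eq0 s.
    by rewrite Ec size_mul // s.
  by rewrite poly_unitE (negPf sr).
have [[c1 u] /= c10 E1] := Pdiv.Idomain.dvdpP _ _ (Pdiv.Idomain.dvdp_gcdl q a).
have [[c2 v] /= c20 E2] := Pdiv.Idomain.dvdpP _ _ (Pdiv.Idomain.dvdp_gcdr q a).
rewrite -mul_polyC in E1; rewrite -mul_polyC in E2; set d := gcdp q a in E1 E2.
rewrite mulrC in E1; rewrite mulrC in E1.
have E1' : c1%:P * q = d * u by rewrite E1 mulrC.
have [c3 [d' [u' [c30 Ed Eq]]]] := gauss_split c10 E1'.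
case: (iq _ _ Eq) => [ud|uu].
  right; have [[x y] /= /Pdiv.Idomain.eqpP[[c4 c5] /= /andP[c40 c50] Ex]] := Pdiv.Idomain.Bezoutp q a.
  apply: (@irreducible_cancel (c5 * c3) q b (d'^-1 * (c4%:P * (x * b + y * w)))) => //.
    by rewrite mulf_neq0.
  have E4 : c4%:P * (x * q + y * a) = c5%:P * d by rewrite !mul_polyC.
  have E5 : (c5 * c3)%:P = d'^-1 * (c4%:P * (x * q + y * a)).
    rewrite E4 Ed; transitivity ((d'^-1 * d') * (c5%:P * c3%:P)); last by ring.
    by rewrite mulVr // mul1r polyCM.
  rewrite E5; transitivity (d'^-1 * (c4%:P * (x * q * b + y * (a * b)))); first by ring.
  by rewrite Eab; ring.
left; apply: (@irreducible_cancel c2 q a (u'^-1 * (v * c3%:P))) => //.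
rewrite E2 Ed Eq; transitivity ((u' * u'^-1) * (v * (c3%:P * d'))); last by ring.
by rewrite mulrV // mul1r.
Qed.

End Gauss.

Section Iso.
Variable k : fieldType.
Notation A := {mpoly k[2]}.
Notation S := {poly {poly k}}.

Let var_pp (i : 'I_2) : S := if (i : nat) == 0%N then 'X else 'X%:P.
(** An isomorphism with the polynomials in one variable over those in the other, used to
transport primality. *)
Definition to_pp : {rmorphism A -> S} := mmap (@polyC _ \o @polyC k) var_pp.
Let cf1 : commr_rmorph (@mpolyC 2 k) ('X_ord_max : A). Proof. by move=> x; apply: mulrC. Qed.
Let g : {rmorphism {poly k} -> A} := horner_morph cf1.
Let cf2 : commr_rmorph g ('X_ord0 : A). Proof. by move=> x; apply: mulrC. Qed.
Definition of_pp : {rmorphism S -> A} := horner_morph cf2.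

Lemma of_ppK : cancel of_pp to_pp.
Proof.
have X0 : to_pp 'X_ord0 = 'X by rewrite /= mmapX mmap1U.
have X1 : to_pp 'X_ord_max = 'X%:P by rewrite /= mmapX mmap1U.
have gK c : to_pp (g c) = c%:P.
  elim/poly_ind: c => [|p c IH]; first by rewrite !rmorph0.
  rewrite !rmorphD !rmorphM IH; congr (_ * _ + _).
    by apply: etrans X1; congr (to_pp _); rewrite /= horner_morphX.
  by have -> : g c%:P = c%:MP; rewrite /= ?horner_morphC // mmapC.
move=> p; elim/poly_ind: p => [|p c IH]; first by rewrite !rmorph0.
rewrite !rmorphD !rmorphM IH; congr (_ * _ + _).
  by apply: etrans X0; congr (to_pp _); rewrite /= horner_morphX.
by apply: etrans (gK c); congr (to_pp _); apply: horner_morphC.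
Qed.

Lemma to_ppK : cancel to_pp of_pp.
Proof.
have Cc (c : k) : of_pp (to_pp c%:MP) = c%:MP.
  by rewrite /= mmapC /= horner_morphC /= horner_morphC.
have Xi (i : 'I_2) : of_pp (to_pp 'X_i) = 'X_i.
  rewrite /= mmapX mmap1U /var_pp; case: i => -[|[|//]] p /=.
    by rewrite horner_morphX; congr ('X_[U_(_)]); apply: val_inj.
  by rewrite horner_morphC /= horner_morphX; congr ('X_[U_(_)]); apply: val_inj.
elim/mpolyind => [|c m p _ _ IH]; first by rewrite !rmorph0.
rewrite !rmorphD IH -mul_mpolyC !rmorphM Cc mpolyXE_id !rmorph_prod.
congr (_ * _ + _); apply: eq_bigr => i _.
by rewrite !rmorphXn Xi.
Qed.

Lemma irreducible_prime (q a b : A) : q != 0 -> irreducible q -> divides q (a * b) ->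
  divides q a \/ divides q b.
Proof.
move=> q0 iq [w E].
have := @irreducible_prime_bivariate k (to_pp q) (to_pp a) (to_pp b).
case.
- by apply: contraNneq q0 => h; rewrite -(to_ppK q) h rmorph0.
- move=> u v h; have := iq (of_pp u) (of_pp v); rewrite -rmorphM -h to_ppK => /(_ erefl).
  by case=> /(rmorph_unit to_pp); rewrite of_ppK; [left | right].
- by exists (to_pp w); rewrite -!rmorphM E.
- by case=> c Ec; left; exists (of_pp c); rewrite -{1}(to_ppK q) -rmorphM -Ec to_ppK.
- by case=> c Ec; right; exists (of_pp c); rewrite -{1}(to_ppK q) -rmorphM -Ec to_ppK.
Qed.

End Iso.

(** * Derivations of the polynomial plane *)

Lemma iter_additive0 (V : zmodType) (f : {additive V -> V}) n : iter n f 0 = 0.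
Proof. by elim: n => //= n ->; rewrite raddf0. Qed.

Lemma iterD_additive (V : zmodType) (f : {additive V -> V}) n (u v : V) :
  iter n f (u + v) = iter n f u + iter n f v.
Proof. by elim: n => //= n ->; rewrite raddfD. Qed.

Lemma last_iter (V : zmodType) (f : V -> V) a n : a != 0 -> iter n f a = 0 ->
  exists m, iter m f a != 0 /\ iter m.+1 f a = 0.
Proof.
elim: n => [/negPf an /eqP|n IH a0 h]; first by rewrite an.
have [/(IH a0) //|h'] := eqVneq (iter n f a) 0.
by exists n.
Qed.

Section Derivation.
Variable k : fieldType.
Hypothesis char0 : forall n, (n.+1)%:R != 0 :> k.
Notation A := {mpoly k[2]}.
Variable D : {linear A -> A}.
Hypothesis leib : leibniz D.
Implicit Types a b s t q : A.

Lemma mulrn_mpoly_eq0 n a : a *+ n.+1 = 0 -> a = 0.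
Proof.
by rewrite -scaler_nat => /eqP; rewrite scaler_eq0 (negPf (char0 _)) => /eqP.
Qed.

Lemma der1 : D 1 = 0.
Proof. by have := leib 1 1; rewrite !mulr1 mul1r => /eqP; rewrite -subr_eq subrr eq_sym => /eqP. Qed.

Lemma derC c : D c%:MP = 0.
Proof. by rewrite -[c%:MP]mulr1 mul_mpolyC linearZ /= der1 scaler0. Qed.

Lemma derXn a n : D (a ^+ n.+1) = (a ^+ n * D a) *+ n.+1.
Proof.
elim: n => [|n IH]; first by rewrite expr1 mul1r.
rewrite exprS leib IH mulrnAr mulrA -exprS [RHS]mulrS mulrC; congr (_ + _).
Qed.

Lemma divides_mulr q a b : divides q a -> divides q (a * b).
Proof. by case=> c ->; exists (c * b); rewrite mulrA. Qed.
Lemma divides_mull q a b : divides q b -> divides q (a * b).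
Proof. by rewrite mulrC; apply: divides_mulr. Qed.
Lemma divides_add q a b : divides q a -> divides q b -> divides q (a + b).
Proof. by case=> c -> [d ->]; exists (c + d); rewrite mulrDr. Qed.
Lemma divides_opp q a : divides q a -> divides q (- a).
Proof. by case=> c ->; exists (- c); rewrite mulrN. Qed.
Lemma divides_0 q : divides q 0.
Proof. by exists 0; rewrite mulr0. Qed.
Lemma divides_sum q (I : Type) (r : seq I) (P : pred I) (F : I -> A) :
  (forall i, P i -> divides q (F i)) -> divides q (\sum_(i <- r | P i) F i).
Proof. by move=> h; apply: big_ind => //; [apply: divides_0 | move=> x y; apply: divides_add]. Qed.
Lemma divides_der q a : divides q (D q) -> divides q a -> divides q (D a).
Proof.
move=> qq [c ->]; rewrite leib; apply: divides_add; first exact: divides_mulr.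
by exists (D c).
Qed.
Lemma divides_nat q a n : divides q (a *+ n.+1) -> divides q a.
Proof.
case=> c E; exists ((n.+1)%:R^-1 *: c); rewrite -scalerAr -E -scaler_nat scalerA.
by rewrite mulVf ?scale1r.
Qed.

(** Read q as a prime element or as 0.  Modulo q, the elements b i lie in the kernel of
the induced derivation of a domain, and t does not; such a t is transcendental over
the kernel.  Indeed, applying D to a relation and cancelling D t gives a relation of
lower degree, with coefficients (i+1) b_(i+1). *)
Lemma transcendental q t n (b : nat -> A) :
  (forall x y, divides q (x * y) -> divides q x \/ divides q y) -> divides q (D q) ->
  ~ divides q (D t) -> (forall i, divides q (D (b i))) ->
  divides q (\sum_(i < n) b i * t ^+ i) -> forall i, (i < n)%N -> divides q (b i).
Proof.
move=> pq qq qt; elim: n b => [//|n IH] b hb hs.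
have hD : divides q ((\sum_(i < n) (b i.+1 *+ i.+1) * t ^+ i) * D t).
  have E : D (\sum_(i < n.+1) b i * t ^+ i) = \sum_(i < n.+1) D (b i) * t ^+ i +
      (\sum_(i < n) (b i.+1 *+ i.+1) * t ^+ i) * D t.
    rewrite raddf_sum /=; under eq_bigr => i _ do rewrite leib.
    rewrite big_split /=; congr (_ + _); rewrite big_ord_recl expr0 der1 mulr0 add0r.
    rewrite mulr_suml; apply: eq_bigr => i _; rewrite lift0 derXn.
    by rewrite mulrnAr mulrA -mulrnAl -mulrnAl.
  have -> : (\sum_(i < n) (b i.+1 *+ i.+1) * t ^+ i) * D t =
     D (\sum_(i < n.+1) b i * t ^+ i) + - \sum_(i < n.+1) D (b i) * t ^+ i.
    by rewrite E addrC addKr.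
  apply: divides_add; first exact: divides_der.
  by apply/divides_opp/divides_sum => i _; apply: divides_mulr.
case: (pq _ _ hD) => // hS.
have h1 i : (i < n)%N -> divides q (b i.+1).
  move=> lin; apply: divides_nat; apply: (IH (fun i => b i.+1 *+ i.+1)) => // j.
  have -> : D (b j.+1 *+ j.+1) = D (b j.+1) * j.+1%:R by rewrite raddfMn /= mulr_natr.
  exact/divides_mulr/hb.
case=> [_|i]; last by rewrite ltnS; apply: h1.
have -> : b 0%N = \sum_(i < n.+1) b i * t ^+ i + - \sum_(i < n) b i.+1 * t ^+ i.+1.
  rewrite big_ord_recl expr0 mulr1 -[LHS]addr0 -addrA; congr (_ + _).
  by rewrite -sumrN -big_split big1 // => i _; rewrite lift0 /= subrr.
apply: divides_add => //; apply/divides_opp/divides_sum => i _.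
by apply: divides_mulr; apply: h1.
Qed.

(** The leading term of the Leibniz formula for the iterates of D; only the fact that its
binomial coefficient is positive is kept. *)
Lemma iter_der_mul m n a b : iter m.+1 D a = 0 -> iter n.+1 D b = 0 ->
  exists c : nat, iter (m + n) D (a * b) = (iter m D a * iter n D b) *+ c.+1.
Proof.
move: {2}(m + n)%N (erefl (m + n)%N) => N; elim: N m n a b => [|N IH] m n a b.
  by move=> /eqP; rewrite addn_eq0 => /andP[/eqP -> /eqP ->] _ _; exists 0%N.
move=> Emn ha hb; rewrite Emn iterSr leib iterD_additive.
case: m Emn ha => [|m] Emn ha.
  have Da : D a = 0 by [].
  case: n Emn hb => // n [] Emn hb; rewrite Da mul0r iter_additive0 add0r.
  have [|c] := IH 0%N n a (D b) Emn ha; first by rewrite -iterSr.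
  by rewrite -Emn => ->; exists c; rewrite -iterSr.
have [||c1 E1] := IH m n (D a) b _ _ hb; [lia | by rewrite -iterSr | ].
have N1 : N = (m + n)%N by lia.
rewrite {1}N1 E1; case: n Emn hb N1 E1 => [|n] Emn hb N1 E1.
  have Db : D b = 0 by [].
  by rewrite Db mulr0 iter_additive0 addr0; exists c1; rewrite -iterSr.
have [||c2 E2] := IH m.+1 n a (D b) _ ha; [lia | by rewrite -iterSr | ].
have N2 : N = (m.+1 + n)%N by lia.
rewrite N2 E2 -!iterSr -mulrnDr; exists (c1 + c2.+1)%N.
by rewrite addSn.
Qed.

Definition locally_nilpotent := forall a, exists n, iter n D a = 0.

(** The number of iterations of a locally nilpotent derivation that do not kill an
element behaves like a degree, by [iter_der_mul], so it is 0 for both factors. *)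
Lemma ker_factor a b : locally_nilpotent -> a * b != 0 -> D (a * b) = 0 -> D a = 0.
Proof.
move=> nD; rewrite mulf_eq0 negb_or => /andP[a0 b0] Dab.
have [na ha] := nD a; have [nb hb] := nD b.
have [m [m0 m1]] := last_iter a0 ha; have [n [n0 n1]] := last_iter b0 hb.
have [c E] := iter_der_mul m1 n1.
case: m m0 m1 E => [//|m] m0 m1 E.
have : iter m D a = 0 \/ True by right.
move=> _; move: E; rewrite addSn iterSr Dab iter_additive0 => /esym /mulrn_mpoly_eq0 /eqP.
by rewrite mulf_eq0 (negPf m0) (negPf n0).
Qed.

(** D(s^(j+1) a / (j+1)) = s^j a + s^(j+1) (D a) / (j+1), and D a dies one step earlier
than a.  The powers of s are needed for the induction; j = 0 is the point. *)
Lemma slice_onto s n a : D s = 1 -> iter n D a = 0 -> forall j, exists b, D b = s ^+ j * a.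
Proof.
move=> Ds; elim: n a => [|n IH] a.
  by move=> /= -> j; exists 0; rewrite mulr0 raddf0.
rewrite iterSr => /IH h j; have [b Eb] := h j.+1.
exists ((j.+1)%:R^-1 *: (s ^+ j.+1 * a - b)).
rewrite linearZ raddfB /= leib derXn Ds mulr1 Eb addrK mulrnAl -scaler_nat scalerA.
by rewrite mulVf // scale1r.
Qed.
End Derivation.

(** * Base change *)

Notation iX := (ord0 : 'I_2).
Notation iY := (ord_max : 'I_2).

Section Der.
Variable k : fieldType.
Notation A := {mpoly k[2]}.
Implicit Types a b P Q : A.

Definition der P Q a : A := P * a^`M(iX) + Q * a^`M(iY).

Fact der_linear P Q : linear (der P Q).
Proof.
move=> c a b; rewrite /der !linearP /= !mulrDr !scalerDr -!scalerAr.
by rewrite addrACA.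
Qed.
HB.instance Definition _ P Q := GRing.isLinear.Build k A A _ (der P Q) (der_linear P Q).

Lemma der_leibniz P Q : leibniz (der P Q).
Proof. by move=> a b; rewrite /der !mderivM; ring. Qed.

Lemma mnm_subnn (m : 'X_{1..2}) : (m - m)%MM = 0%MM.
Proof. by apply/mnmP => j; rewrite mnmBE mnm0E subnn. Qed.

Lemma derX0 P Q : der P Q 'X_iX = P.
Proof.
by rewrite /der !mderivX !mnm1E !eqxx /= scale0r mulr0 addr0 scale1r mnm_subnn mpolyX0 mulr1.
Qed.
Lemma derX1 P Q : der P Q 'X_iY = Q.
Proof.
by rewrite /der !mderivX !mnm1E !eqxx /= scale0r mulr0 add0r scale1r mnm_subnn mpolyX0 mulr1.
Qed.

Lemma der_ext (D1 D2 : {linear A -> A}) : leibniz D1 -> leibniz D2 ->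
  D1 'X_iX = D2 'X_iX -> D1 'X_iY = D2 'X_iY -> D1 =1 D2.
Proof.
move=> l1 l2 e0 e1.
have eX n i : D1 ('X_i ^+ n) = D2 ('X_i ^+ n).
  case: n => [|n]; first by rewrite expr0 !der1.
  rewrite !derXn //; congr (_ * _ *+ _).
  by case: i => -[|[|//]] p; [have -> : Ordinal p = iX by apply: val_inj |
     have -> : Ordinal p = iY by apply: val_inj].
elim/mpolyind => [|c m p _ _ IH]; first by rewrite !raddf0.
rewrite !raddfD /= IH !linearZ /= mpolyXE_id big_ord_recl big_ord1.
by rewrite l1 l2 !eX.
Qed.

Lemma derE (D : {linear A -> A}) : leibniz D -> D =1 der (D 'X_iX) (D 'X_iY).
Proof.
move=> lD; apply: der_ext => //; first exact: der_leibniz.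
  by rewrite /= derX0.
by rewrite /= derX1.
Qed.
End Der.

Section BaseChange.
Variables (k k' : fieldType) (e : extension k k').
Notation A := {mpoly k[2]}.
Notation A' := {mpoly k'[2]}.

(** Extension of scalars on polynomials; [retp] applies the retraction to the coefficients. *)
Definition extp : {rmorphism A -> A'} := map_mpoly (ext_inj e).
Definition retp : {additive A' -> A} := map_mpoly (ext_ret e).

Lemma mcoeff_extp m a : (extp a)@_m = ext_inj e a@_m. Proof. exact: mcoeff_map_mpoly. Qed.
Lemma mcoeff_retp m a : (retp a)@_m = ext_ret e a@_m. Proof. exact: mcoeff_map_mpoly. Qed.

Lemma ext_injK c : ext_ret e (ext_inj e c) = c.
Proof. by rewrite -[ext_inj e c]mulr1 ext_retM ext_ret1 mulr1. Qed.

Lemma extpK : cancel extp retp.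
Proof. by move=> a; apply/mpolyP => m; rewrite mcoeff_retp mcoeff_extp ext_injK. Qed.

(** The retraction is linear over the small polynomial ring, which is why it commutes with
derivations defined there ([retp_der]). *)
Lemma retpM a v : retp (extp a * v) = a * retp v.
Proof.
apply/mpolyP => m; rewrite mcoeff_retp !mcoeffM raddf_sum; apply: eq_bigr => i _.
by rewrite mcoeff_extp /= ext_retM mcoeff_retp.
Qed.

Lemma retp_der P Q v : retp (der (extp P) (extp Q) v) = der P Q (retp v).
Proof.
have rd i : retp v^`M(i) = (retp v)^`M(i).
  by apply/mpolyP => m; rewrite mcoeff_retp !mcoeff_deriv mcoeff_retp raddfMn.
by rewrite /der raddfD /= !retpM !rd.
Qed.

Lemma extp_der P Q a : extp (der P Q a) = der (extp P) (extp Q) (extp a).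
Proof.
have rd i : extp a^`M(i) = (extp a)^`M(i).
  by apply/mpolyP => m; rewrite mcoeff_extp !mcoeff_deriv mcoeff_extp rmorphMn.
by rewrite /der rmorphD !rmorphM !rd.
Qed.

Lemma extp_deg1 a : deg1 (extp a) = deg1 a.
Proof.
rewrite /deg1 !msizeE (perm_big _ (msupp_map_mpoly _ _)) //.
exact: fmorph_inj.
Qed.

Lemma extpC c : extp c%:MP = (ext_inj e c)%:MP. Proof. exact: map_mpolyC. Qed.
Lemma extpX m : extp 'X_[m] = 'X_[m]. Proof. exact: map_mpolyX. Qed.
Lemma extp_eq0 a : (extp a == 0) = (a == 0).
Proof. by rewrite -!deg1_eq0 extp_deg1. Qed.

Lemma extp_lnd P Q : locally_nilpotent (der P Q) -> locally_nilpotent (der (extp P) (extp Q)).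
Proof.
move=> h; elim/mpolyind => [|c m p _ _ [n IH]]; first by exists 0%N.
have [n' E] := h 'X_[m]; exists (n' + n)%N.
have E' : iter n' (der (extp P) (extp Q)) 'X_[m] = 0.
  rewrite -(extpX m) -(rmorph0 extp) -E; elim: n' {E} => //= n' ->.
  by rewrite extp_der.
have Ec j v : iter j (der (extp P) (extp Q)) (c *: v) = c *: iter j (der (extp P) (extp Q)) v.
  by elim: j => //= j ->; rewrite linearZ.
rewrite iterD_additive Ec addnC iterD E' iter_additive0 scaler0 add0r.
by rewrite addnC iterD IH iter_additive0.
Qed.
End BaseChange.

Lemma extp_comp (k k1 k2 : fieldType) (e : extension k k1) (f : extension k1 k2) a :
  extp (ext_comp e f) a = extp f (extp e a).
Proof. by apply/mpolyP => m; rewrite !mcoeff_extp. Qed.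

(** Induction on the degree; the noninvertible polynomials are the zero one and those of
positive degree. *)
Lemma irreducible_divisor (k : fieldType) (h : {mpoly k[2]}) : (1 < deg1 h)%N ->
  exists q, [/\ irreducible q, (1 < deg1 q)%N & divides q h].
Proof.
have szu (u : {mpoly k[2]}) : u != 0 -> u \isn't a GRing.unit -> (1 < deg1 u)%N.
  move=> u0; apply: contraNT; rewrite -leqNgt => /deg1_constP E.
  move: u0; rewrite E => u0; apply: rmorph_unit; rewrite unitfE.
  by apply: contraNneq u0 => ->; rewrite mpolyC0.
move: (leqnn (deg1 h)); move: {2}(deg1 h) => n; elim: n h => [h|n IH h sh h1]; first lia.
have [irr|nirr] := boolp.pselect (irreducible h).
  by exists h; split => //; exists 1; rewrite mulr1.
have [u [v [E nu nv]]] : exists u v, [/\ h = u * v, u \isn't a GRing.unit & v \isn't a GRing.unit].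
  apply: boolp.contrapT => H; apply: nirr => u v E.
  have [uu|nu] := boolP (u \is a GRing.unit); first by left.
  have [uv|nv] := boolP (v \is a GRing.unit); first by right.
  by case: H; exists u, v.
have h0 : h != 0 by rewrite -deg1_gt0 ltnW.
move: (h0); rewrite E mulf_eq0 negb_or => /andP[u0 v0].
have su := szu _ u0 nu; have sv := szu _ v0 nv.
have [|q [iq sq qu]] := IH u _ su.
  by move: sh; rewrite E deg1M //; lia.
by exists q; split=> //; rewrite ?E; apply: divides_mulr.
Qed.

(** * Images of locally nilpotent derivations *)

Section Ev.
Variable k : fieldType.
Notation A := {mpoly k[2]}.
Definition evalp (p : {poly k}) (u : A) : A := (map_poly (@mpolyC 2 k) p).[u].

Lemma evalpE (p : {poly k}) u N : (size p <= N)%N -> evalp p u = \sum_(i < N) p`_i *: u ^+ i.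
Proof.
move=> sp; rewrite /evalp (@horner_coef_wide _ N) ?(leq_trans (size_poly _ _)) //.
by apply: eq_bigr => i _; rewrite coef_map /= mul_mpolyC.
Qed.

Lemma evalp_poly (al : nat -> k) u N : evalp (\poly_(i < N) al i) u = \sum_(i < N) al i *: u ^+ i.
Proof.
rewrite (@evalpE _ _ N) ?size_poly //; apply: eq_bigr => i _.
by rewrite coef_poly ltn_ord.
Qed.

Lemma evalp_const p u : p != 0 -> evalp p u = 0 -> (deg1 u <= 1)%N.
Proof. by move=> p0; rewrite (@evalpE _ _ (size p)) // => /(algebraic_const p0). Qed.

(** Used to reduce a relation among s, t and q modulo q without losing it: divide by the
largest possible power of q first. *)
Lemma divides_lowest_coef (q : A) N (c : nat -> A) l : q != 0 -> (l < N)%N ->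
  (forall j, (j < l)%N -> c j = 0) -> \sum_(j < N) c j * q ^+ j = 0 -> divides q (c l).
Proof.
move=> q0; elim: l N c => [|l IH] [//|N] c lN cl; rewrite big_ord_recl expr0 mulr1.
  move=> /eqP; rewrite addr_eq0 => /eqP ->.
  exists (- \sum_(j < N) c j.+1 * q ^+ j); rewrite mulrN mulr_sumr; congr (- _).
  by apply: eq_bigr => i _; rewrite lift0 exprS mulrCA.
rewrite cl // add0r => E.
apply: (IH N (fun j => c j.+1)) => // [j jl|]; first exact: cl.
apply: (mulfI q0); rewrite mulr0 -[RHS]E mulr_sumr.
by apply: eq_bigr => i _; rewrite lift0 exprS mulrCA.
Qed.

(** The relation between s, t and q given by [algebraic_dependence3] becomes a relation
between s and t modulo q.  Modulo q, t is transcendental over the kernel of D, so the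
coefficients of that relation with respect to t vanish; they are polynomials in s. *)
Lemma algebraic_mod (char0 : forall n, (n.+1)%:R != 0 :> k) (D : {linear A -> A}) (q s t : A) :
  leibniz D -> q != 0 -> (forall x y, divides q (x * y) -> divides q x \/ divides q y) ->
  divides q (D q) -> divides q (D s) -> ~ divides q (D t) ->
  exists2 p, p != 0 & divides q (evalp p s).
Proof.
move=> lD q0 pq qq qs qt.
have [N [al [[i0 [j0 [l0 [iN jN lN aln]]]] H]]] := algebraic_dependence3 s t q.
pose Pl l := (l < N)%N && [exists i : 'I_N, [exists j : 'I_N, al i j l != 0]].
have exl : exists l, Pl l.
  exists l0; rewrite /Pl lN; apply/existsP; exists (Ordinal iN).
  by apply/existsP; exists (Ordinal jN).
case: (ex_minnP exl) => l /andP[ltl /existsP[i /existsP[j aij]]] lmin.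
pose c l := \sum_(j < N) (\sum_(i < N) al i j l *: s ^+ i) * t ^+ j.
have cE l' : c l' = \sum_(i < N) \sum_(j < N) al i j l' *: (s ^+ i * t ^+ j).
  rewrite exchange_big; apply: eq_bigr => j' _; rewrite mulr_suml.
  by apply: eq_bigr => i' _; rewrite scalerAl.
have hc : divides q (c l).
  apply: (@divides_lowest_coef q N c l) => // [j' jl|].
    rewrite cE big1 // => i1 _; rewrite big1 // => j1 _.
    suff -> : al i1 j1 j' = 0 by rewrite scale0r.
    apply/eqP/negPn/negP => h; move: (jl); rewrite ltnNge lmin //.
    rewrite /Pl (ltn_trans jl ltl); apply/existsP; exists i1.
    by apply/existsP; exists j1.
  rewrite -[RHS]H; under eq_bigr => l' _ do rewrite cE.
  rewrite [RHS](eq_bigr (fun i : 'I_N =>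
    \sum_(l < N) \sum_(j < N) al i j l *: (s ^+ i * t ^+ j * q ^+ l))); last first.
    by move=> i1 _; rewrite exchange_big.
  rewrite [RHS]exchange_big; apply: eq_bigr => l' _; rewrite mulr_suml.
  apply: eq_bigr => i' _; rewrite mulr_suml; apply: eq_bigr => j' _.
  by rewrite -scalerAl.
have hd (j1 : nat) : divides q (D (\sum_(i < N) al i j1 l *: s ^+ i)).
  rewrite raddf_sum /=; apply: divides_sum => i1 _; rewrite linearZ /= -mul_mpolyC.
  apply: divides_mull; case: (nat_of_ord i1) => [|n].
    by rewrite expr0 der1 //; apply: divides_0.
  by rewrite derXn // -mulr_natr; apply: divides_mulr; apply: divides_mull.
have h := transcendental char0 lD pq qq qt hd hc.
exists (\poly_(i < N) al i j l); last by rewrite evalp_poly; apply: (h j).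
by apply: contraNneq aij => E; rewrite -(coef0 _ i) -E coef_poly ltn_ord.
Qed.
End Ev.

Lemma divides_const (k : fieldType) (q : {mpoly k[2]}) c :
  c != 0 -> divides q c%:MP -> (deg1 q <= 1)%N.
Proof.
by move=> c0 [w E]; apply: (@const_factor k q w); rewrite -E ?mpolyC_eq0 // deg1C c0.
Qed.

Lemma divides_prod (k : fieldType) (q : {mpoly k[2]}) (I : Type) (rs : seq I)
  (F : I -> {mpoly k[2]}) :
  (forall x y, divides q (x * y) -> divides q x \/ divides q y) -> (1 < deg1 q)%N ->
  divides q (\prod_(r <- rs) F r) -> exists r, divides q (F r).
Proof.
move=> pq sq; elim: rs => [|r rs IH]; rewrite ?big_nil ?big_cons.
  by move=> h; have := @divides_const k q 1 (oner_neq0 _); rewrite mpolyC1 leqNgt sq => /(_ h).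
by case/pq => [h|/IH //]; exists r.
Qed.

Lemma divides_ext (k k' : fieldType) (e : extension k k') q a :
  divides q a -> divides (extp e q) (extp e a).
Proof. by case=> c ->; exists (extp e c); rewrite rmorphM. Qed.

Lemma extp_evalp (k k' : fieldType) (e : extension k k') p u :
  extp e (evalp p u) = evalp (map_poly (ext_inj e) p) (extp e u).
Proof.
rewrite /evalp -horner_map -!map_poly_comp; congr horner; apply: eq_map_poly => c /=.
exact: extpC.
Qed.

(** Induction on the degree of h, over all fields at once since the field grows.  With
q an irreducible factor of h, the degree drops by dividing the derivation by q if q
divides both coefficients, and otherwise by dividing s - r by a factor of q for a root
r of the polynomial that [algebraic_mod] provides. *)
Lemma lnd_image_principal n (k : fieldType) (char0 : forall n, (n.+1)%:R != 0 :> k)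
  (P Q s h : {mpoly k[2]}) : locally_nilpotent (der P Q) -> der P Q s = h -> h != 0 ->
  der P Q h = 0 -> (deg1 h <= n)%N ->
  exists (k' : fieldType) (e : extension k k') (g : {mpoly k'[2]}),
    forall a, (exists b, der (extp e P) (extp e Q) b = a) <-> divides g a.
Proof.
elim: n k char0 P Q s h => [|n IH] k char0 P Q s h nD Ds h0 Dh sh.
  by move: sh; rewrite leqn0 deg1_eq0 (negPf h0).
have lD := der_leibniz P Q.
have [h1|h1] := leqP (deg1 h) 1.
  have Eh := deg1_constP h1; move: h0; rewrite Eh mpolyC_eq0; set c := h@_0 => c0.
  exists k, (ext_id k), 1 => a; split=> _; first by exists a; rewrite mul1r.
  have mpid x : extp (ext_id k) x = x by apply/mpolyP => m; rewrite mcoeff_extp.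
  rewrite !mpid; have [m Em] := nD a.
  have Ds1 : der P Q (c^-1 *: s) = 1.
    by rewrite linearZ /= Ds Eh -mul_mpolyC -mpolyCM mulVf.
  have [b Eb] := slice_onto char0 lD Ds1 Em 0.
  by exists b; rewrite Eb expr0 mul1r.
have [q [iq sq [h2 Eh]]] := irreducible_divisor h1.
have q0 : q != 0 by rewrite -deg1_gt0 ltnW.
have pq x y := @irreducible_prime k q x y q0 iq.
have Dq : der P Q q = 0.
  by apply: (ker_factor char0 lD (b := h2)) => //; rewrite -Eh.
have h20 : h2 != 0 by apply: contraNneq h0 => E; rewrite Eh E mulr0.
have sh2 : (deg1 h2 <= n)%N by move: sh; rewrite Eh deg1M //; lia.
(* Either q divides the derivation, or it does not kill both coordinates modulo q. *)
have [[[P1 EP] [Q1 EQ]]|nPQ] := boolp.pselect (divides q P /\ divides q Q).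
  have EE a : der P Q a = q * der P1 Q1 a.
    by rewrite /der EP EQ; ring.
  have Eq : der P1 Q1 q = 0.
    by apply: (mulfI q0); rewrite -EE Dq mulr0.
  have lE := der_leibniz P1 Q1.
  have nE : locally_nilpotent (der P1 Q1).
    move=> a; have [m Em] := nD a; exists m.
    have E j : iter j (der P Q) a = q ^+ j * iter j (der P1 Q1) a.
      elim: j => [|j IHj]; first by rewrite mul1r.
      have Eqj : der P1 Q1 (q ^+ j) = 0.
        by case: (j) => [|j']; rewrite ?expr0 ?(der1 lE) // (derXn lE) /= Eq mulr0 mul0rn.
      by rewrite /= IHj EE lE Eqj mul0r add0r mulrA -exprS.
    apply: (mulfI (expf_neq0 m q0)).
    by rewrite -E Em mulr0.
  have Es : der P1 Q1 s = h2.
    by apply: (mulfI q0); rewrite -EE Ds Eh.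
  have Eh2 : der P1 Q1 h2 = 0.
    apply: (mulfI (mulf_neq0 q0 q0)); rewrite mulr0 -[RHS]Dh EE Eh lE Eq mul0r add0r.
    by rewrite mulrA.
  have [k' [e [g Hg]]] := IH k char0 P1 Q1 s h2 nE Es h20 Eh2 sh2.
  exists k', e, (extp e q * g) => a.
  have EE' b : der (extp e P) (extp e Q) b = extp e q * der (extp e P1) (extp e Q1) b.
    by rewrite /der EP EQ !rmorphM; ring.
  split=> [[b <-]|[c Ea]].
    have [c Ec] : divides g (der (extp e P1) (extp e Q1) b) by apply/Hg; exists b.
    by exists c; rewrite EE' Ec mulrA.
  have [b Eb] : exists b, der (extp e P1) (extp e Q1) b = g * c by apply/Hg; exists c.
  by exists b; rewrite EE' Eb mulrA.
have [t nt] : exists t, ~ divides q (der P Q t).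
  apply: boolp.contrapT => H; apply: nPQ; split; apply: boolp.contrapT => h'; apply: H.
    by exists 'X_iX; rewrite derX0.
  by exists 'X_iY; rewrite derX1.
have [|| p p0 qp] := @algebraic_mod k char0 (der P Q) q s t lD q0 pq _ _ nt.
- by rewrite /= Dq; apply: divides_0.
- by rewrite /= Ds; exists h2.
have [k1 [e [rs Ep]]] := ext_split p0.
have ch1 := ext_char0 (ext_inj e) char0.
have sq1 : (1 < deg1 (extp e q))%N by rewrite extp_deg1.
have [q' [iq' sq' dq']] := irreducible_divisor sq1.
have q'0 : q' != 0 by rewrite -deg1_gt0 ltnW.
have pq' x y := @irreducible_prime k1 q' x y q'0 iq'.
have [c Ec] : divides q' (extp e h).
  case: dq' => w Ew; exists (w * extp e h2).
  by rewrite Eh rmorphM Ew; ring.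
have [r [s' Es']] : exists r, divides q' (extp e s - r%:MP).
  have : divides q' (evalp (map_poly (ext_inj e) p) (extp e s)).
    rewrite -extp_evalp; case: dq' => w Ew; case: (divides_ext e qp) => w' Ew'.
    by exists (w * w'); rewrite Ew' Ew mulrA.
  rewrite Ep /evalp map_polyZ rmorph_prod /= hornerZ horner_prod.
  case/pq'.
    move=> hc; have := @divides_const k1 q' (ext_inj e (lead_coef p)) _ hc.
    by rewrite fmorph_eq0 lead_coef_eq0 p0 leqNgt sq' => /(_ isT).
  case/(divides_prod pq' sq') => r; rewrite map_polyXsubC hornerXsubC => hr.
  by exists r.
set P' := extp e P; set Q' := extp e Q.
have lD' := der_leibniz P' Q'.
have nD' : locally_nilpotent (der P' Q') by apply: extp_lnd.
have h'0 : extp e h != 0 by rewrite extp_eq0.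
have Dh' : der P' Q' (extp e h) = 0 by rewrite -extp_der Dh rmorph0.
have Dq' : der P' Q' q' = 0.
  by apply: (ker_factor ch1 lD' (b := c)) => //; rewrite -Ec.
have Ds' : der P' Q' s' = c.
  apply: (mulfI q'0); rewrite -Ec -Ds extp_der -/P' -/Q'.
  transitivity (der P' Q' (q' * s')); first by rewrite lD' Dq' mul0r add0r.
  by rewrite -Es' raddfB /= derC // subr0.
have c0 : c != 0 by apply: contraNneq h'0 => E; rewrite Ec E mulr0.
have Dc : der P' Q' c = 0.
  apply: (ker_factor ch1 lD' (b := q')) => //; first by rewrite mulrC -Ec.
  by rewrite mulrC -Ec.
have sc : (deg1 c <= n)%N.
  by move: sh; rewrite -(extp_deg1 e) Ec deg1M //; lia.
have [k2 [f [g Hg]]] := IH k1 ch1 P' Q' s' c nD' Ds' c0 Dc sc.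
exists k2, (ext_comp e f), g => a.
by rewrite !extp_comp.
Qed.

(** Up to a field extension the image is a principal ideal, and the retraction turns
membership of b a over the extension into membership over k. *)
Lemma lnd_image_ideal (k : fieldType) (char0 : forall n, (n.+1)%:R != 0 :> k)
  (D : {linear {mpoly k[2]} -> {mpoly k[2]}}) : leibniz D -> locally_nilpotent D ->
  forall a b, (exists c, D c = a) -> exists c, D c = b * a.
Proof.
move=> lD nD a b [c Dc].
have [a0|a0] := eqVneq a 0; first by exists 0; rewrite raddf0 a0 mulr0.
have c0 : c != 0 by apply: contraNneq a0 => c0; rewrite -Dc c0 raddf0.
have [m Em] := nD a; have [j [j0 j1]] := last_iter a0 Em.
set P := D 'X_iX; set Q := D 'X_iY.
have DE := derE lD.
have itE i x : iter i D x = iter i (der P Q) x by elim: i => //= i ->; rewrite DE.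
have nPQ : locally_nilpotent (der P Q) by move=> x; have [i Ei] := nD x; exists i; rewrite -itE.
have [||k' [e [g Hg]]] := @lnd_image_principal _ k char0 P Q
  (iter j D c) (iter j D a) nPQ _ j0 _ (leqnn _).
- by rewrite -DE -iterS iterSr Dc.
- by rewrite -DE.
have [w Ew] : divides g (extp e (b * a)).
  rewrite rmorphM; apply: divides_mull; apply/Hg; exists (extp e c).
  by rewrite -extp_der -DE Dc.
have [v Ev] : exists v, der (extp e P) (extp e Q) v = extp e (b * a) by apply/Hg; exists w.
by exists (retp e v); rewrite DE -retp_der Ev extpK.
Qed.

(** * Generalized eigenspaces *)

Section Weights.
Variable k : fieldType.
Hypothesis char0 : forall n, (n.+1)%:R != 0 :> k.
Notation A := {mpoly k[2]}.
Variable D : {linear A -> A}.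
Hypothesis leib : leibniz D.
Implicit Types (a b u v w : A) (c d lam : k) (l : seq (k * A)).

Definition shift c a : A := D a - c *: a.
Fact shift_linear c : linear (shift c).
Proof.
move=> x a b; rewrite /shift linearP /= scalerDr !scalerBr !scalerA [c * x]mulrC.
by rewrite opprD addrACA.
Qed.
HB.instance Definition _ c := GRing.isLinear.Build k A A _ (shift c) (shift_linear c).

Lemma shift0 a : shift 0 a = D a.
Proof. by rewrite /shift scale0r subr0. Qed.
Lemma shiftC c d a : shift c (shift d a) = shift d (shift c a).
Proof.
rewrite /shift !raddfB /= !linearZ /= ?scalerBr !scalerA [d * c]mulrC.
by rewrite !addrA; congr (_ + _); rewrite addrAC.
Qed.
Lemma shiftM c d a b : shift (c + d) (a * b) = shift c a * b + a * shift d b.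
Proof.
rewrite /shift leib scalerDl mulrBl mulrBr -scalerAl -scalerAr opprD.
by rewrite addrACA.
Qed.

(** Membership in the generalized eigenspace of D for c. *)
Definition weight c a := exists n, iter n (shift c) a = 0.

Lemma weight0 c : weight c 0. Proof. by exists 0%N. Qed.
Lemma weightD c a b : weight c a -> weight c b -> weight c (a + b).
Proof.
move=> [n En] [m Em]; exists (n + m)%N; rewrite iterD_additive {1}addnC !iterD En Em.
by rewrite !iter_additive0 addr0.
Qed.
Lemma iterZ n c d a : iter n (shift c) (d *: a) = d *: iter n (shift c) a.
Proof. by elim: n => //= n ->; rewrite linearZ. Qed.
Lemma weightZ c d a : weight c a -> weight c (d *: a).
Proof. by move=> [n En]; exists n; rewrite iterZ En scaler0. Qed.
Lemma weightN c a : weight c a -> weight c (- a).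
Proof. by rewrite -scaleN1r; apply: weightZ. Qed.
Lemma weight_sum c (I : Type) (r : seq I) (P : pred I) (F : I -> A) :
  (forall i, P i -> weight c (F i)) -> weight c (\sum_(i <- r | P i) F i).
Proof. by move=> h; apply: big_ind => //; [apply: weight0 | move=> x y; apply: weightD]. Qed.
Lemma iter_shiftC n c d a : iter n (shift c) (shift d a) = shift d (iter n (shift c) a).
Proof. by elim: n => //= n ->; rewrite shiftC. Qed.
Lemma weight_shift c d a : weight c a -> weight c (shift d a).
Proof. by move=> [n En]; exists n; rewrite iter_shiftC En raddf0. Qed.
Lemma weight_der c a : weight c a -> weight c (D a).
Proof. by rewrite -shift0; apply: weight_shift. Qed.
Lemma weight_unshift c a : weight c (shift c a) -> weight c a.
Proof. by move=> [n En]; exists n.+1; rewrite iterSr. Qed.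

(** By [shiftM], shifted iterates obey a Leibniz rule, so n + m steps are enough. *)
Lemma weightM c d a b : weight c a -> weight d b -> weight (c + d) (a * b).
Proof.
move=> [n En] [m Em]; exists (n + m)%N.
move: {2}(n + m)%N (erefl (n + m)%N) => N; elim: N n m a b En Em => [|N IH] n m a b En Em E.
  move: En; have -> : n = 0%N by lia.
  by move=> /= ->; rewrite mul0r iter_additive0.
case: n En E => [|n] En E; first by move: En => /= ->; rewrite mul0r iter_additive0.
case: m Em E => [|m] Em E; first by rewrite (_ : b = 0) ?mulr0 ?iter_additive0.
rewrite addSn iterSr shiftM iterD_additive (IH n m.+1) -?iterSr //; last lia.
by rewrite add0r -addSnnS (IH n.+1 m) -?iterSr //; lia.
Qed.

Lemma weight1 : weight 0 1.
Proof. by exists 1%N; rewrite /= shift0 der1. Qed.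
Lemma weightC c : weight 0 c%:MP.
Proof. by exists 1%N; rewrite /= shift0 derC. Qed.
Lemma weightX c a n : weight c a -> weight (c *+ n) (a ^+ n).
Proof.
move=> ga; elim: n => [|n IH]; first exact: weight1.
by rewrite mulrS exprS; apply: weightM.
Qed.

(** On the eigenspace of lam, D - c is the nonzero scalar lam - c plus a nilpotent map. *)
Lemma weight_solve lam c w : lam != c -> weight lam w -> exists2 u, weight lam u & shift c u = w.
Proof.
move=> lc [n]; elim: n w => [|n IH] w.
  by move=> /= ->; exists 0; [apply: weight0 | rewrite raddf0].
rewrite iterSr => En; have [u gu Eu] := IH _ En.
have lc0 : lam - c != 0 by rewrite subr_eq0.
exists ((lam - c)^-1 *: (w - u)).
  by apply/weightZ/weightD; [exists n.+1; rewrite iterSr | apply: weightN].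
have E : shift c w - shift c u = (lam - c) *: w.
  by rewrite Eu /shift opprB addrC addrA subrK -scalerBl.
by rewrite linearZ /= -[shift c (w - u)]/(_) (linearB (shift c)) /= E scalerA mulVf // scale1r.
Qed.

Lemma weight_inj lam c u : lam != c -> weight lam u -> weight c u -> u = 0.
Proof.
move=> lc gu [n En].
have h v : weight lam v -> shift c v = 0 -> v = 0.
  move=> [m Em] sv; have Dv : D v = c *: v by apply/eqP; rewrite -subr_eq0; apply/eqP.
  have Ei i : iter i (shift lam) v = (c - lam) ^+ i *: v.
    elim: i => [|i IH]; first by rewrite scale1r.
    by rewrite /= IH /shift linearZ /= Dv exprS !scalerA -scalerBl [_ * c]mulrC -mulrBl.
  move: Em; rewrite Ei => /eqP; rewrite scaler_eq0 expf_eq0 subr_eq0 eq_sym (negPf lc) andbF /=.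
  by move/eqP.
elim: n En => [//|n IH] En; apply: IH; apply: h => //.
have : weight lam (iter n (shift c) u).
  by elim: n {En} => //= n; apply: weight_shift.
by [].
Qed.

(** Weights may be repeated in such a list, which makes sums and products of
decompositions straightforward; [component] collects the terms of equal weight. *)
Definition weighted l := forall x, x \in l -> weight x.1 x.2.
Definition total_of l : A := \sum_(x <- l) x.2.
Definition component c l : A := \sum_(x <- l | x.1 == c) x.2.

Lemma weighted_cons x l : weighted (x :: l) <-> weight x.1 x.2 /\ weighted l.
Proof.
split=> [h|[gx gl] y]; first by split=> [|y yl]; apply: h; rewrite inE ?eqxx ?yl ?orbT.
by rewrite inE => /predU1P[->|/gl].
Qed.
Lemma weighted_cat l1 l2 : weighted l1 -> weighted l2 -> weighted (l1 ++ l2).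
Proof. by move=> h1 h2 x; rewrite mem_cat => /orP[/h1|/h2]. Qed.
Lemma weighted_filter (p : pred (k * A)) l : weighted l -> weighted (filter p l).
Proof. by move=> gl x; rewrite mem_filter => /andP[_ /gl]. Qed.

Lemma weight_component c l : weighted l -> weight c (component c l).
Proof.
move=> gl; rewrite /component big_seq_cond; apply: weight_sum => x /andP[/gl gx /eqP <-] //.
Qed.

(** A power of D - d kills the terms of a weight d different from c and is injective on
the eigenspace of c, so the terms of the other weights can be removed one weight
after the other. *)
Lemma weight_indep l : weighted l -> total_of l = 0 -> forall c, component c l = 0.
Proof.
move=> gl tl c; move: (leqnn (size l)); move: {2}(size l) => n.
elim: n l gl tl => [|n IH] l gl tl sl.
  by move: sl; rewrite leqn0 => /nilP ->; rewrite /component big_nil.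
have [alc|] := boolP (all (fun x => x.1 == c) l).
  rewrite -tl /component /total_of big_seq_cond [RHS]big_seq_cond; apply: eq_bigl => x.
  by case xl: (x \in l) => //=; rewrite (allP alc).
rewrite -has_predC => /hasP[[d u0] /= dl dc].
have [N HN] : exists N, forall x, x \in l -> x.1 = d -> iter N (shift d) x.2 = 0.
  elim: l gl {tl sl dl IH} => [|x l IH] gl; first by exists 0%N.
  have /weighted_cons[gx gl'] := gl; have [N HN] := IH gl'.
  have [xd|xd] := eqVneq x.1 d; last first.
    by exists N => y; rewrite inE => /predU1P[-> E|/HN //]; rewrite E eqxx in xd.
  move: gx; rewrite xd => -[M HM]; exists (M + N)%N => y.
  rewrite inE => /predU1P[-> _|/HN h /h E].
    by rewrite addnC iterD HM iter_additive0.
  by rewrite iterD E iter_additive0.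
(* Applying (D - d)^N removes the terms of weight d. *)
pose l2 := [seq (x.1, iter N (shift d) x.2) | x <- l & x.1 != d].
have sl2 : (size l2 <= n)%N.
  rewrite size_map -ltnS; apply: leq_trans sl.
  rewrite size_filter -(count_predC (fun x : k * A => x.1 != d) l) -[X in (X < _)%N]addn0 ltn_add2l.
  by rewrite -has_count; apply/hasP; exists (d, u0) => //=; rewrite negbK.
have gl2 : weighted l2.
  move=> y /mapP[x]; rewrite mem_filter => /andP[_ /gl gx] -> /=.
  by elim: (N) => //= m; apply: weight_shift.
have itsum (P : pred (k * A)) s : iter N (shift d) (\sum_(x <- s | P x) x.2) =
    \sum_(x <- s | P x) iter N (shift d) x.2.
  by apply: (big_morph _ (iterD_additive _ N)); rewrite iter_additive0.
have tl2 : total_of l2 = 0.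
  transitivity (iter N (shift d) (total_of l)); last by rewrite tl iter_additive0.
  rewrite /total_of big_map big_filter itsum.
  rewrite [RHS](bigID (fun x => x.1 != d)) /=.
  suff -> : \sum_(x <- l | ~~ (x.1 != d)) iter N (shift d) x.2 = 0 by rewrite addr0.
  rewrite big_seq_cond big1 // => x /andP[xl]; rewrite negbK => /eqP; exact: HN.
have := IH l2 gl2 tl2 sl2; rewrite /component big_map big_filter_cond.
rewrite (eq_bigl (fun x => x.1 == c)); last first.
  move=> x; rewrite andbC; case: eqP => //= ->; by rewrite eq_sym.
rewrite -itsum => E; apply: (@weight_inj c d) => //.
- by rewrite eq_sym.
- exact: weight_component.
by exists N.
Qed.

Lemma weight_family_indep (I : finType) (wt : I -> k) (F : I -> A) :
  (forall i, weight (wt i) (F i)) -> injective wt -> \sum_i F i = 0 -> forall i, F i = 0.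
Proof.
move=> gF ext_inj S0 i.
have gl : weighted [seq (wt j, F j) | j <- enum I].
  by move=> x /mapP[j _ ->] /=; apply: gF.
have tl : total_of [seq (wt j, F j) | j <- enum I] = 0.
  by rewrite /total_of big_map big_enum.
have := weight_indep gl tl (wt i); rewrite /component big_map big_enum_cond (big_pred1 i) // => j /=.
by rewrite (inj_eq ext_inj).
Qed.

Lemma component_unique l1 l2 c :
  weighted l1 -> weighted l2 -> total_of l1 = total_of l2 -> component c l1 = component c l2.
Proof.
move=> g1 g2 E.
set l := l1 ++ [seq (x.1, - x.2) | x <- l2].
have gl : weighted l.
  by apply: weighted_cat => // y /mapP[x /g2 gx ->] /=; apply: weightN.
have tl : total_of l = 0.
  by rewrite /total_of big_cat big_map /= sumrN; apply/eqP; rewrite subr_eq0; apply/eqP.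
have := weight_indep gl tl c; rewrite /component big_cat big_map /= sumrN.
by move/eqP; rewrite subr_eq0 => /eqP.
Qed.

Definition decomposable a := exists2 l, weighted l & total_of l = a.

Lemma decomposable0 : decomposable 0. Proof. by exists [::] => //; rewrite /total_of big_nil. Qed.
Lemma decomposable_weight c a : weight c a -> decomposable a.
Proof. by move=> ga; exists [:: (c, a)]; [apply/weighted_cons | rewrite /total_of big_seq1]. Qed.
Lemma decomposableD a b : decomposable a -> decomposable b -> decomposable (a + b).
Proof.
move=> [l gl <-] [l' gl' <-]; exists (l ++ l'); first exact: weighted_cat.
by rewrite /total_of big_cat.
Qed.
Lemma decomposableM a b : decomposable a -> decomposable b -> decomposable (a * b).
Proof.
move=> [l gl <-] [l' gl' <-].
exists [seq (x.1 + y.1, x.2 * y.2) | x <- l, y <- l'].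
  by move=> z /allpairsP[[x y] /= [/gl gx /gl' gy ->]]; apply: weightM.
rewrite /total_of big_allpairs_dep mulr_suml; apply: eq_bigr => x _.
by rewrite mulr_sumr.
Qed.

(** A preimage under D - c is found term by term, except for the terms of weight c; what
remains of a is mapped by D - c into the eigenspace of c, so it has weight c. *)
Lemma decomposable_unshift c a : decomposable (shift c a) -> decomposable a.
Proof.
move=> [l gl E].
have [v dv gv] : exists2 v, decomposable v & weight c (shift c v - total_of l).
  elim: l gl {E} => [|x l IH] gl.
    by exists 0; [apply: decomposable0 | rewrite /total_of big_nil subr0 raddf0; apply: weight0].
  have /weighted_cons[gx /IH[v dv gv]] := gl.
  rewrite /total_of big_cons; have [xc|xc] := eqVneq x.1 c.
    exists v => //; rewrite opprD addrCA addrC; apply: weightD => //.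
    by rewrite -xc; apply: weightN.
  have [u gu Eu] := weight_solve xc gx.
  exists (u + v); first by apply: decomposableD => //; apply: decomposable_weight gu.
  by rewrite raddfD /= Eu opprD addrACA subrr add0r.
rewrite -(subrK v a) addrC; apply: decomposableD => //; apply: (@decomposable_weight c).
apply: weight_unshift; rewrite raddfB /= -E -opprB; exact: weightN.
Qed.

Lemma decomposable_roots cs a : foldl (fun v c => shift c v) a cs = 0 -> decomposable a.
Proof.
elim: cs a => [|c cs IH] a /= E; first by rewrite E; apply: decomposable0.
by apply: (@decomposable_unshift c); apply: IH.
Qed.

Lemma decomposable_all : decomposable 'X_iX -> decomposable 'X_iY -> forall a, decomposable a.
Proof.
move=> d0 d1.
have dC c : decomposable c%:MP by apply: decomposable_weight (weightC c).
have dX i n : decomposable ('X_i ^+ n).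
  elim: n => [|n IH]; first by rewrite expr0 -mpolyC1.
  rewrite exprS; apply: decomposableM => //; case: i {IH} => -[|[|//]] p.
    by have -> : Ordinal p = iX by apply: val_inj.
  by have -> : Ordinal p = iY by apply: val_inj.
elim/mpolyind => [|c m p _ _ IH]; first exact: decomposable0.
apply: decomposableD => //; rewrite -mul_mpolyC; apply: decomposableM => //.
by rewrite mpolyXE_id big_ord_recl big_ord1; apply: decomposableM.
Qed.
End Weights.

(** * Semisimple and nilpotent parts *)

Lemma mulrn_inj (k : fieldType) (c : k) : (forall n, (n.+1)%:R != 0 :> k) -> c != 0 ->
  injective (fun n : nat => c *+ n).
Proof.
move=> char0 c0 i j; wlog ij : i j / (j <= i)%N.
  move=> h E; have [ji|/ltnW ji] := leqP j i; first exact: h.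
  by apply/esym/h.
move=> /eqP; rewrite -subr_eq0 -mulrnBr // -mulr_natr mulf_eq0 (negPf c0) /=.
case E : (i - j)%N => [|m]; last by rewrite (negPf (char0 _)).
by move=> _; apply/eqP; rewrite eqn_leq ij andbT -subn_eq0 E.
Qed.

Section Jordan.
Variable k : fieldType.
Hypothesis char0 : forall n, (n.+1)%:R != 0 :> k.
Notation A := {mpoly k[2]}.
Variable D : {linear A -> A}.
Hypothesis leib : leibniz D.
Hypothesis decA : forall a, decomposable D a.
Implicit Types (a b u v w : A) (c d lam : k) (l : seq (k * A)).

Definition weighted_sum l : A := \sum_(x <- l) x.1 *: x.2.

(** Grouping the terms by weights: each group contributes its weight times its sum. *)
Lemma weighted_sum0 l : (forall c, component c l = 0) -> weighted_sum l = 0.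
Proof.
move: (leqnn (size l)); move: {2}(size l) => n; elim: n l => [|n IH] l sl h.
  by move: sl; rewrite leqn0 => /nilP ->; rewrite /weighted_sum big_nil.
case: l sl h => [|[c u] l0]; first by rewrite /weighted_sum big_nil.
set l := (c, u) :: l0 => sl h.
rewrite /weighted_sum (bigID (fun x => x.1 == c)) /=.
have -> : \sum_(x <- l | x.1 == c) x.1 *: x.2 = 0.
  rewrite (eq_bigr (fun x => c *: x.2)); last by move=> x /eqP ->.
  by rewrite -scaler_sumr -/(component c l) h scaler0.
rewrite add0r -big_filter; apply: IH.
  rewrite /= eqxx /=; apply: leq_trans (_ : size l0 <= n)%N; last by [].
  by rewrite size_filter count_size.
move=> d; rewrite /component big_filter_cond; have [->|dc] := eqVneq d c.
  by rewrite big1 // => x /andP[/negPf ->].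
rewrite -[RHS](h d); apply: eq_bigl => x.
by have [->|_] := eqVneq x.1 d; rewrite ?dc ?andbF.
Qed.

Lemma weighted_sum_unique l1 l2 :
  weighted D l1 -> weighted D l2 -> total_of l1 = total_of l2 -> weighted_sum l1 = weighted_sum l2.
Proof.
move=> g1 g2 E; set l := l1 ++ [seq (x.1, - x.2) | x <- l2].
have : weighted_sum l = 0.
  apply: weighted_sum0 => c; rewrite /component big_cat big_map /= sumrN.
  by apply/eqP; rewrite subr_eq0; apply/eqP; apply: (component_unique c g1 g2 E).
rewrite /weighted_sum big_cat big_map /=; under [X in _ + X]eq_bigr => x _ do rewrite scalerN.
by rewrite sumrN => /eqP; rewrite subr_eq0 => /eqP.
Qed.

Definition decomposition a : seq (k * A) := s2val (boolp.cid2 (decA a)).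
Lemma decomposition_weighted a : weighted D (decomposition a).
Proof. exact: s2valP (boolp.cid2 (decA a)). Qed.
Lemma decomposition_total a : total_of (decomposition a) = a.
Proof. exact: s2valP' (boolp.cid2 (decA a)). Qed.

(** The derivation that multiplies a vector of weight c by c; that it is independent of
the chosen decomposition is [sspartE]. *)
Definition sspart a : A := weighted_sum (decomposition a).
Lemma sspartE l : weighted D l -> sspart (total_of l) = weighted_sum l.
Proof. by move=> gl; apply: weighted_sum_unique => //; [apply: decomposition_weighted | rewrite decomposition_total]. Qed.

Fact sspart_linear : linear sspart.
Proof.
move=> c a b; pose l := [seq (x.1, c *: x.2) | x <- decomposition a] ++ decomposition b.
have gl : weighted D l.
  apply: weighted_cat (@decomposition_weighted b) => y /mapP[x /decomposition_weighted gx ->] /=; exact: weightZ.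
have tl : total_of l = c *: a + b.
  by rewrite /total_of big_cat big_map /= -scaler_sumr -!/(total_of _) !decomposition_total.
rewrite -{1}tl sspartE // /weighted_sum big_cat big_map /= scaler_sumr; congr (_ + _).
by apply: eq_bigr => x _; rewrite !scalerA mulrC.
Qed.
HB.instance Definition _ := GRing.isLinear.Build k A A _ sspart sspart_linear.

Lemma sspart_leibniz : leibniz sspart.
Proof.
move=> a b; pose l := [seq (x.1 + y.1, x.2 * y.2) | x <- decomposition a, y <- decomposition b].
have gl : weighted D l.
  by move=> z /allpairsP[[x y] /= [/decomposition_weighted gx /decomposition_weighted gy ->]]; apply: weightM.
have tl : total_of l = a * b.
  transitivity (total_of (decomposition a) * total_of (decomposition b)); last by rewrite !decomposition_total.
  rewrite /total_of big_allpairs_dep mulr_suml.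
  by apply: eq_bigr => x _; rewrite mulr_sumr.
rewrite -{1}tl sspartE //.
transitivity (weighted_sum (decomposition a) * total_of (decomposition b) +
    total_of (decomposition a) * weighted_sum (decomposition b)).
  2: by rewrite !decomposition_total.
rewrite /weighted_sum /total_of big_allpairs_dep /= !mulr_suml -big_split /=; apply: eq_bigr => x _.
rewrite !mulr_sumr -big_split /=; apply: eq_bigr => y _.
by rewrite scalerDl -scalerAl -scalerAr.
Qed.

Definition nilpart a : A := D a - sspart a.
Fact nilpart_linear : linear nilpart.
Proof.
move=> c a b; rewrite /nilpart !linearP /= scalerDr -!addrA; congr (_ + _).
by rewrite addrCA.
Qed.
HB.instance Definition _ := GRing.isLinear.Build k A A _ nilpart nilpart_linear.

Lemma nilpart_leibniz : leibniz nilpart.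
Proof. by move=> a b; rewrite /nilpart leib sspart_leibniz; ring. Qed.

Lemma nilpart_weight c a : weight D c a -> nilpart a = shift D c a.
Proof.
move=> ga; have gl : weighted D [:: (c, a)] by apply/weighted_cons.
by have := sspartE gl; rewrite /total_of /weighted_sum !big_seq1 /= /nilpart => ->.
Qed.

Lemma weight_nilpart c a : weight D c a -> weight D c (nilpart a).
Proof. by move=> ga; rewrite (nilpart_weight ga); apply: weight_shift. Qed.

Lemma iter_nilpart c a n : weight D c a ->
  iter n nilpart a = iter n (shift D c) a /\ weight D c (iter n nilpart a).
Proof.
move=> ga; elim: n => [|n [E g]] //=; split; last exact: weight_nilpart.
by rewrite (nilpart_weight g) E.
Qed.

Lemma nilpart_nilpotent c a : weight D c a -> exists n, iter n nilpart a = 0.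
Proof. by move=> ga; have [n En] := ga; exists n; rewrite (iter_nilpart n ga).1. Qed.

Lemma nilpart_last c a : weight D c a -> a != 0 ->
  exists m, [/\ iter m nilpart a != 0, nilpart (iter m nilpart a) = 0 & weight D c (iter m nilpart a)].
Proof.
move=> ga a0; have [n En] := nilpart_nilpotent ga.
have [m [m0 m1]] := last_iter a0 En; exists m; split=> //.
exact: (iter_nilpart m ga).2.
Qed.

Definition in_im a := exists b, D b = a.
Lemma in_im0 : in_im 0. Proof. by exists 0; rewrite raddf0. Qed.
Lemma in_imD a b : in_im a -> in_im b -> in_im (a + b).
Proof. by case=> u <- [v <-]; exists (u + v); rewrite raddfD. Qed.
Lemma in_im_sum (I : eqType) (r : seq I) (F : I -> A) :
  (forall i, i \in r -> in_im (F i)) -> in_im (\sum_(i <- r) F i).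
Proof. by move=> h; rewrite big_seq; apply: big_ind => //; [apply: in_im0 | apply: in_imD]. Qed.
Lemma in_im_weight c a : weight D c a -> c != 0 -> in_im a.
Proof. by move=> ga c0; have [u _ Eu] := weight_solve c0 ga; exists u; rewrite -shift0. Qed.

(** D preserves weights, so the weight 0 part of D y is the image of that of y. *)
Lemma in_im_component0 l : weighted D l -> in_im (total_of l) ->
  exists2 y, weight D 0 y & component 0 l = D y.
Proof.
move=> gl [y Ey]; exists (component 0 (decomposition y)); first exact/weight_component/decomposition_weighted.
pose l' := [seq (x.1, D x.2) | x <- decomposition y].
have gl' : weighted D l' by move=> z /mapP[x /decomposition_weighted gx ->] /=; apply: weight_der.
have E : total_of l = total_of l'.
  by rewrite -Ey -{1}(decomposition_total y) /total_of big_map raddf_sum.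
by rewrite (component_unique 0 gl gl' E) /component big_map raddf_sum.
Qed.

Lemma const_gen0 a : (deg1 a <= 1)%N -> weight D 0 a.
Proof. by move=> /deg1_constP ->; apply: weightC. Qed.

(** The image is the sum of the eigenspaces of nonzero weights.  It absorbs products: if
the weights of two vectors add up to 0, their product is constant; were it nonzero,
both would be constants, that is, of weight 0. *)
Lemma case_constant_weight0 : (forall z : A, weight D 0 z -> (deg1 z <= 1)%N) ->
  forall a b, in_im a -> in_im (b * a).
Proof.
move=> triv a b ia.
have [l gl ta] : exists2 l, weighted D l & total_of l = a by apply: decA.
have [y gy Ey] : exists2 y, weight D 0 y & component 0 l = D y by apply: in_im_component0; rewrite ?ta.
have c0 : component 0 l = 0 by rewrite Ey (deg1_constP (triv _ gy)) derC.
have Ea : a = \sum_(x <- l | x.1 != 0) x.2.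
  by rewrite -ta /total_of (bigID (fun x => x.1 == 0)) /= -/(component 0 l) c0 add0r.
rewrite Ea -big_filter mulr_sumr; apply: in_im_sum => x.
rewrite mem_filter => /andP[x10 /gl gx].
rewrite -(decomposition_total b) mulr_suml; apply: in_im_sum => z /decomposition_weighted gz.
have gzx := weightM leib gz gx.
have [e|ne] := eqVneq (z.1 + x.1) 0; last exact: in_im_weight ne.
have [->|n0] := eqVneq (z.2 * x.2) 0; first exact: in_im0.
have szc : (deg1 (z.2 * x.2) <= 1)%N by apply: triv; rewrite -e.
have sx : (deg1 x.2 <= 1)%N by apply: (@const_factor k _ z.2); rewrite mulrC.
have : x.2 = 0 by apply: (weight_inj x10 gx); apply: const_gen0.
by move=> E; move: n0; rewrite E mulr0 eqxx.
Qed.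

Lemma case_nilpotent : (forall c a, weight D c a -> a != 0 -> c = 0) ->
  forall a b, in_im a -> in_im (b * a).
Proof.
move=> h a b; apply: (lnd_image_ideal char0 leib) => {}a.
rewrite -(decomposition_total a); move: (@decomposition_weighted a); elim: (decomposition a) => [|x l IH] gl.
  by exists 0%N; rewrite /total_of big_nil.
have /weighted_cons[gx gl'] := gl; have [n En] := IH gl'.
have [m Em] : exists m, iter m D x.2 = 0.
  have [->|n0] := eqVneq x.2 0; first by exists 0%N.
  move: (gx); rewrite (h _ _ gx n0) => -[m Em]; exists m; rewrite -Em.
  by elim: (m) => //= j ->; rewrite shift0.
exists (n + m)%N; rewrite /total_of big_cons iterD_additive {1}iterD Em iter_additive0 add0r.
by rewrite addnC iterD En iter_additive0.
Qed.

(** Take a relation among c, b0 and t.  As t is transcendental over the kernel of the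
nilpotent part, its coefficients, polynomials in c and b0, vanish; as the powers of b0
have distinct weights, the coefficients of these, polynomials in c alone, vanish too.
So c is algebraic over k. *)
Lemma ker0_const (t : A) (nu : k) (b0 c : A) :
  nilpart t != 0 -> nu != 0 -> weight D nu b0 -> b0 != 0 ->
  nilpart b0 = 0 -> weight D 0 c -> nilpart c = 0 -> (deg1 c <= 1)%N.
Proof.
move=> dt nu0 gb b00 db gc dc.
have [N [al [[i0 [j0 [l0 [iN jN lN aln]]]] H]]] := algebraic_dependence3 c b0 t.
pose F (l : nat) := \sum_(j < N) (\sum_(i < N) al i j l *: c ^+ i) * b0 ^+ j.
have dX u n : nilpart u = 0 -> nilpart (u ^+ n) = 0.
  case: n => [|n] du; first by rewrite expr0 (der1 nilpart_leibniz).
  by rewrite (derXn nilpart_leibniz) /= du mulr0 mul0rn.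
have dF (l : nat) : nilpart (F l) = 0.
  rewrite raddf_sum big1 // => j _ /=; rewrite nilpart_leibniz dX // mulr0 addr0.
  rewrite raddf_sum big1 ?mul0r // => i _ /=; by rewrite linearZ /= dX // scaler0.
have SF : \sum_(l < N) F l * t ^+ l = 0.
  rewrite -[RHS]H.
  rewrite [RHS](eq_bigr (fun i : 'I_N =>
    \sum_(l < N) \sum_(j < N) al i j l *: (c ^+ i * b0 ^+ j * t ^+ l))); last first.
    by move=> i1 _; rewrite exchange_big.
  rewrite [RHS]exchange_big; apply: eq_bigr => l _; rewrite [RHS]exchange_big mulr_suml.
  apply: eq_bigr => j _; rewrite !mulr_suml; apply: eq_bigr => i _.
  by rewrite -!scalerAl.
have dvd0 (x : A) : divides 0 x -> x = 0 by case=> y ->; rewrite mul0r.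
have F0 : F l0 = 0.
  apply: (dvd0); apply: (transcendental char0 nilpart_leibniz (t := t) (b := F) (n := N)) => //.
  - move=> x y /dvd0/eqP; rewrite mulf_eq0 => /orP[] /eqP ->; [left|right]; exact: divides_0.
  - by rewrite raddf0; apply: divides_0.
  - by move/dvd0/eqP; rewrite (negPf dt).
  - by move=> i; rewrite /= dF; apply: divides_0.
  - by rewrite SF; apply: divides_0.
pose G (j : 'I_N) := (\sum_(i < N) al i j l0 *: c ^+ i) * b0 ^+ j.
have gG (j : 'I_N) : weight D (nu *+ j) (G j).
  rewrite -[nu *+ j]add0r; apply: (weightM leib); last exact: weightX.
  apply: weight_sum => i _; apply: weightZ; rewrite -(mul0rn _ i); exact: weightX.
have winj : injective (fun j : 'I_N => nu *+ j).
  by move=> j1 j2 /(mulrn_inj char0 nu0)/val_inj.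
have := weight_family_indep gG winj F0 (Ordinal jN); rewrite /G /= => /eqP.
rewrite mulf_eq0 expf_eq0 (negPf b00) andbF orbF -(evalp_poly (fun i => al i j0 l0)) => /eqP.
apply: evalp_const; apply: contraNneq aln => E.
by rewrite -(coef0 _ i0) -E coef_poly iN.
Qed.

End Jordan.

(** * The four cases *)

Section Cases.
Variable k : fieldType.
Hypothesis char0 : forall n, (n.+1)%:R != 0 :> k.
Notation A := {mpoly k[2]}.
Variable D : {linear A -> A}.
Hypothesis leib : leibniz D.
Hypothesis decA : forall a, decomposable D a.
Implicit Types (a b u v w : A) (lam : k) (l : seq (k * A)).
Notation nilpart := (nilpart decA).

(** The last nonzero iterate of the nilpotent part on c0 is a constant by [ker0_const];
the iterate before it is a slice of weight 0. *)
Lemma case_slice (c0 b t : A) (nu : k) : weight D 0 c0 -> (1 < deg1 c0)%N ->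
  nu != 0 -> weight D nu b -> b != 0 -> nilpart t != 0 -> forall a, in_im D a.
Proof.
move=> gc sc nu0 gb b0 dt a.
have [m [m0 dm gm]] := nilpart_last decA gb b0.
have kc z : weight D 0 z -> nilpart z = 0 -> (deg1 z <= 1)%N.
  exact: (ker0_const char0 leib dt nu0 gm m0 dm).
have dc : nilpart c0 != 0.
  by apply: contraTneq sc => /(kc _ gc); rewrite -leqNgt.
have [j [j0 dj gj]] := nilpart_last decA (weight_nilpart decA gc) dc.
have Ej := deg1_constP (kc _ gj dj); set c := _@_0 in Ej.
have cn0 : c != 0 by apply: contraNneq j0 => E; rewrite Ej E mpolyC0.
set y := iter j nilpart c0.
have gy : weight D 0 y by case: (iter_nilpart decA j gc).
have Dy : D y = c%:MP.
  by rewrite -Ej -iterSr /= -/y (nilpart_weight decA gy) shift0.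
have Ds : D (c^-1 *: y) = 1.
  by rewrite linearZ /= Dy -mul_mpolyC -mpolyCM mulVf.
have h0 w : weight D 0 w -> in_im D w.
  move=> [n En]; have En' : iter n D w = 0.
    by rewrite -En; elim: (n) => //= i ->; rewrite shift0.
  have [x Ex] := slice_onto char0 leib Ds En' 0.
  by exists x; rewrite Ex expr0 mul1r.
rewrite -(decomposition_total decA a); apply: in_im_sum => x /decomposition_weighted gx.
have [e|ne] := eqVneq x.1 0; last exact: in_im_weight gx ne.
by apply: h0; rewrite -e.
Qed.

Section Semisimple.
Hypothesis ss : forall a, nilpart a = 0.
Variable c0 : A.
Hypotheses (gc0 : weight D 0 c0) (sc0 : (1 < deg1 c0)%N).

(** In a relation among c0, u and v, the monomials u^j v^l cannot all have distinct
weights, since otherwise each coefficient, a polynomial in the nonconstant c0, would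
vanish.  Two monomials of the same weight relate lam and mu. *)
Lemma commensurable lam mu u v : lam != 0 -> mu != 0 -> u != 0 -> v != 0 ->
  weight D lam u -> weight D mu v ->
  exists p q : int, [/\ p != 0, q != 0 & mu *~ p = lam *~ q].
Proof.
move=> lam0 mu0 u0 v0 gu gv.
have [N [al [[i0 [j0 [l0 [iN jN lN aln]]]] H]]] := algebraic_dependence3 c0 u v.
pose wt (x : 'I_N * 'I_N) := lam *+ x.1 + mu *+ x.2.
pose G (x : 'I_N * 'I_N) := (\sum_(i < N) al i x.1 x.2 *: c0 ^+ i) * (u ^+ x.1 * v ^+ x.2).
have gG x : weight D (wt x) (G x).
  rewrite -[wt x]add0r; apply: (weightM leib); last by apply: (weightM leib); apply: weightX.
  by apply: weight_sum => i _; apply: weightZ; rewrite -(mul0rn _ i); apply: weightX.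
have SG : \sum_x G x = 0.
  rewrite -(pair_bigA _ (fun j l1 : 'I_N => G (j, l1))) /= -[RHS]H [RHS]exchange_big /=.
  apply: eq_bigr => j _; rewrite [RHS]exchange_big /=; apply: eq_bigr => l _.
  by rewrite /G mulr_suml; apply: eq_bigr => i _ /=; rewrite -scalerAl mulrA.
have [winj|nwinj] := boolp.pselect (injective wt).
  have := weight_family_indep gG winj SG (Ordinal jN, Ordinal lN); rewrite /G /= => /eqP.
  rewrite mulf_eq0 orbC mulf_eq0 !expf_eq0 (negPf u0) (negPf v0) !andbF /=.
  rewrite -(evalp_poly (fun i => al i j0 l0)) => /eqP /evalp_const => h.
  exfalso; move: sc0; rewrite ltnNge h //; apply: contraNneq aln => E.
  by rewrite -(coef0 _ i0) -E coef_poly iN.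
have [x [y [E ne]]] : exists x y, wt x = wt y /\ x != y.
  apply: boolp.contrapT => h; apply: nwinj => x y E; apply/eqP/negPn/negP => ne.
  by apply: h; exists x, y.
have E' : mu *~ (x.2%:Z - y.2%:Z) = lam *~ (y.1%:Z - x.1%:Z).
  rewrite !mulrzBr -!pmulrn; apply/eqP; rewrite subr_eq addrAC eq_sym subr_eq.
  by rewrite -/(wt y) -E /wt addrC.
have z1 (c : k) (z : int) : c != 0 -> (c *~ z == 0) = (z == 0).
  move=> cn0; case: z => n; rewrite ?NegzE ?mulrNz ?oppr_eq0 -pmulrn -mulr_natr mulf_eq0 (negPf cn0) /=.
    by case: n => [|n]; rewrite ?eqxx // (negPf (char0 _)).
  by rewrite (negPf (char0 _)).
have e12 : (x.2%:Z - y.2%:Z == 0) = (y.1%:Z - x.1%:Z == 0).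
  by rewrite -(z1 mu) // -(z1 lam) // E'.
have ne2 : x.2%:Z - y.2%:Z != 0.
  apply: contraNneq ne => h; have := e12; rewrite h eqxx => /esym.
  rewrite subr_eq0 eqz_nat => /eqP /val_inj h1.
  move: h => /eqP; rewrite subr_eq0 eqz_nat => /eqP /val_inj h2.
  by case: (x) (y) h1 h2 => [x1 x2] [y1 y2] /= -> ->.
by exists (x.2%:Z - y.2%:Z), (y.1%:Z - x.1%:Z); split; rewrite // -e12.
Qed.

(** Zero vectors must be excluded, since they have every weight. *)
Lemma common_unit l : weighted D l -> (forall x, x \in l -> x.2 != 0) ->
  exists2 lam, lam != 0 & forall x, x \in l -> exists n : int, x.1 = lam *~ n.
Proof.
elim: l => [|x l IH] gl nz; first by exists 1; rewrite ?oner_eq0.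
have /weighted_cons[gx gl'] := gl.
have xn : x.2 != 0 by apply: nz; rewrite mem_head.
have [|lam lam0 Hl] := IH gl'; first by move=> y yl; apply: nz; rewrite inE yl orbT.
have [x10|x10] := eqVneq x.1 0.
  exists lam => // y; rewrite inE => /predU1P[->|/Hl //].
  by exists 0; rewrite mulr0z.
have [alz|] := boolP (all (fun y => y.1 == 0) l).
  exists x.1 => // y; rewrite inE => /predU1P[->|yl]; first by exists 1; rewrite mulr1z.
  by exists 0; rewrite mulr0z; apply/eqP; apply: (allP alz).
rewrite -has_predC => /hasP[y yl /= y10].
have yn : y.2 != 0 by apply: nz; rewrite inE yl orbT.
have [p [q [p0 q0 E]]] := commensurable y10 x10 yn xn (gl' _ yl) gx.
have [n En] := Hl _ yl.
have pk : p%:~R != 0 :> k.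
  case: p p0 {E} => [[|m]|m] // _; rewrite ?NegzE ?rmorphN ?oppr_eq0; exact: char0.
have Ep (m : int) : (lam / p%:~R) *~ (m * p) = lam *~ m.
  by rewrite -[RHS]mulrzr -[LHS]mulrzr rmorphM /= mulrCA divfK // mulrC.
(* The weight x.1 equals lam n q / p, so lam / p is a common unit. *)
exists (lam / p%:~R); first by rewrite mulf_neq0 ?invr_eq0.
move=> z; rewrite inE => /predU1P[->|/Hl[m Em]]; last by exists (m * p); rewrite Ep.
exists (n * q); apply: (mulfI pk); rewrite ![p%:~R * _]mulrC mulrzr E En.
by rewrite -[in RHS]mulrzr mulrAC divfK // mulrzr mulrzA.
Qed.

Section Laurent.
Variable lam : k.
(** The polynomial p stands for the Laurent polynomial T^-s p, whose coefficient at T^j has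
weight j lam, and which describes the element p.[1] of A. *)
Definition laurent (s : nat) (p : {poly A}) :=
  forall i : nat, weight D (lam *~ (i%:Z - s%:Z)) p`_i.

Lemma laurentM s s' p p' : laurent s p -> laurent s' p' -> laurent (s + s') (p * p').
Proof.
move=> h h' i; rewrite coefM; apply: weight_sum => j _.
have -> : i%:Z - (s + s')%N%:Z = (j%:Z - s%:Z) + ((i - j)%N%:Z - s'%:Z).
  by rewrite -subzn -1?ltnS // PoszD; ring.
by rewrite mulrzDr; apply: (weightM leib).
Qed.
Lemma laurent1 : laurent 0 1.
Proof.
move=> i; rewrite coef1; case: i => [|i]; last exact: weight0.
by rewrite subrr mulr0z; apply: weight1.
Qed.
Lemma laurentX s p m : laurent s p -> laurent (s * m) (p ^+ m).
Proof.
move=> h; elim: m => [|m IH]; first by rewrite muln0; apply: laurent1.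
by rewrite mulnS exprS; apply: laurentM.
Qed.
Lemma laurentD s p p' : laurent s p -> laurent s p' -> laurent s (p + p').
Proof. by move=> h h' i; rewrite coefD; apply: weightD. Qed.
Lemma laurent_shift s p j : laurent s p -> laurent (s + j) (p * 'X^j).
Proof.
move=> h i; rewrite coefMXn; case: ltnP => ij; first exact: weight0.
have -> : i%:Z - (s + j)%N%:Z = (i - j)%N%:Z - s%:Z by rewrite -subzn // PoszD; ring.
exact: h.
Qed.

Lemma laurent_weight (n : int) u : weight D (lam *~ n) u -> exists s p, laurent s p /\ p.[1] = u.
Proof.
move=> gu; case: n gu => n gu.
  exists 0%N, (u%:P * 'X^n); split; last by rewrite !hornerE expr1n mulr1.
  move=> i; rewrite coefCM coefXn; case: eqP => [->|_]; last by rewrite mulr0; apply: weight0.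
  by rewrite mulr1 subr0.
exists n.+1, u%:P; split; last by rewrite hornerC.
move=> i; rewrite coefC; case: eqP => [->|_]; last exact: weight0.
by rewrite sub0r; move: gu; rewrite NegzE.
Qed.

Lemma laurent_total l : weighted D l -> (forall x, x \in l -> exists n : int, x.1 = lam *~ n) ->
  exists s p, laurent s p /\ p.[1] = total_of l.
Proof.
elim: l => [|x l IH] gl hl.
  by exists 0%N, 0; split; [move=> i; rewrite coef0; apply: weight0 | rewrite horner0 /total_of big_nil].
have /weighted_cons[gx gl'] := gl.
have [|s [p [lp Ep]]] := IH gl'; first by move=> y yl; apply: hl; rewrite inE yl orbT.
have [n En] := hl _ (mem_head x l); rewrite En in gx.
have [s' [p' [lp' Ep']]] := laurent_weight gx.
exists (s + s')%N, (p * 'X^s' + p' * 'X^s); split.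
  by apply: laurentD; [apply: laurent_shift | rewrite addnC; apply: laurent_shift].
by rewrite !hornerE !expr1n !mulr1 Ep Ep' /total_of big_cons addrC.
Qed.

Hypothesis lam0 : lam != 0.

(** The index s is that of the constant term of T^-s p. *)
Lemma laurent_weight_eq0 (i s : nat) : (lam *~ (i%:Z - s%:Z) == 0) = (i == s).
Proof.
have [->|ne] := eqVneq i s; first by rewrite subrr mulr0z eqxx.
apply/negbTE; rewrite -mulrzr mulf_neq0 //.
have : i%:Z - s%:Z != 0 by rewrite subr_eq0 eqz_nat.
case: (_ - _) => [[|m]|m] // _; rewrite ?NegzE ?rmorphN ?oppr_eq0; exact: char0.
Qed.

Lemma laurent_in_im0 s p : laurent s p -> in_im D p.[1] -> p`_s = 0.
Proof.
move=> lp ip; have [ss'|ss'] := leqP (size p) s; first exact: nth_default.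
pose l := [seq (lam *~ (i%:Z - s%:Z), p`_i) | i : 'I_(size p) <- enum 'I_(size p)].
have gl : weighted D l by move=> x /mapP[i _ ->] /=; apply: lp.
have tl : total_of l = p.[1].
  rewrite /total_of big_map big_enum horner_coef; apply: eq_bigr => i _.
  by rewrite expr1n mulr1.
rewrite -tl in ip; have [y gy] := in_im_component0 decA gl ip.
have -> : D y = 0 by rewrite -(shift0 D) -(nilpart_weight decA gy) ss.
rewrite /component big_map big_enum_cond (big_pred1 (Ordinal ss')) // => i /=.
by rewrite laurent_weight_eq0.
Qed.

Lemma laurent_in_im s p : laurent s p -> p`_s = 0 -> in_im D p.[1].
Proof.
move=> lp ps; rewrite horner_coef; apply: in_im_sum => i _; rewrite expr1n mulr1.
have [->|ne] := eqVneq (i : nat) s; first by rewrite ps; apply: in_im0.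
by apply: in_im_weight (lp i) _; rewrite laurent_weight_eq0.
Qed.

End Laurent.

(** By [laurent_in_im] and [laurent_in_im0], membership in the image is the vanishing of a
constant term.  Hence [dvdk], over the field of fractions of A, applies to a, and
multiplying the m-th power of a one-sided Laurent polynomial by a fixed one leaves no
constant term once m is large. *)
Lemma case_semisimple a b : (forall m, (1 <= m)%N -> in_im D (a ^+ m)) ->
  exists N, forall m, (N <= m)%N -> in_im D (b * a ^+ m).
Proof.
move=> ha.
(* Zero vectors are removed, as [common_unit] requires. *)
pose nzl := filter (fun x : k * A => x.2 != 0).
have nz_tot l : total_of (nzl l) = total_of l.
  rewrite /total_of big_filter [RHS](bigID (fun x => x.2 != 0)) /= [X in _ = _ + X]big1 ?addr0 //.
  by move=> x; rewrite negbK => /eqP.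
pose la := nzl (decomposition decA a); pose lb := nzl (decomposition decA b).
have gla : weighted D la by apply/weighted_filter/decomposition_weighted.
have glb : weighted D lb by apply/weighted_filter/decomposition_weighted.
have [||lam lam0 Hl] := @common_unit (la ++ lb).
- exact: weighted_cat.
- by move=> x; rewrite mem_cat !mem_filter => /orP[] /andP[].
have [|s [p [lp Ep]]] := @laurent_total lam la gla.
  by move=> x xl; apply: Hl; rewrite mem_cat xl.
have [|s' [q [lq Eq]]] := @laurent_total lam lb glb.
  by move=> x xl; apply: Hl; rewrite mem_cat xl orbT.
rewrite nz_tot decomposition_total in Ep; rewrite nz_tot decomposition_total in Eq.
have ct m : (0 < m)%N -> (p ^+ m)`_(s * m) = 0.
  move=> m0; apply: (laurent_in_im0 lam0 (laurentX m lp)); rewrite horner_exp Ep; exact: ha.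
have red m : (q * p ^+ m)`_(s' + s * m) = 0 -> in_im D (b * a ^+ m).
  by move=> h; have := laurent_in_im lam0 (laurentM lq (laurentX m lp)) h; rewrite hornerM horner_exp Ep Eq.
pose F : fieldType := {fraction A}.
have chF n : (n.+1)%:R != 0 :> F.
  rewrite -(rmorph_nat (@tofrac A)) tofrac_eq0 -mpolyC_nat mpolyC_eq0; exact: char0.
have [|lowp|sp] := @dvdk F chF (map_poly (@tofrac A) p) s.
- by move=> m m0; rewrite -rmorphXn coef_map ct // rmorph0.
- exists s'.+1 => m ms; apply: red.
  have lp1 : low_zero s.+1 p.
    move=> i lis; have := lowp i lis; rewrite coef_map => /eqP; rewrite tofrac_eq0.
    by move/eqP.
  have lpm : low_zero (s.+1 * m) (p ^+ m).
    elim: (m) => [|j IH]; first by rewrite muln0.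
    by rewrite mulnS exprS; apply: low_zeroM.
  have := @low_zeroM _ 0 _ q _ _ lpm; rewrite add0n => h.
  by apply: h => //; nia.
rewrite size_map_inj_poly ?tofrac0 // in sp; last first.
  by move=> x y /eqP; rewrite tofrac_eq => /eqP.
exists (size q).+1 => m ms; apply: red; apply: nth_default.
have [->|p0] := eqVneq p 0; first by rewrite expr0n; case: m ms => // m _; rewrite mulr0 size_poly0.
have sp0 : (0 < size p)%N by rewrite size_poly_gt0.
apply: leq_trans (size_polyMleq _ _) _.
have := size_poly_exp_leq p m; case: (size p) sp sp0 => // d; nia.
Qed.
End Semisimple.

Lemma mathieu_of_decomposition a b : (forall m, (1 <= m)%N -> in_im D (a ^+ m)) ->
  exists N, forall m, (N <= m)%N -> in_im D (b * a ^+ m).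
Proof.
move=> ha.
have [triv|ntriv] := boolp.pselect (forall z : A, weight D 0 z -> (deg1 z <= 1)%N).
  by exists 1%N => m m1; apply: (case_constant_weight0 leib decA triv); apply: ha.
have [c0 [gc sc]] : exists c0, weight D 0 c0 /\ (1 < deg1 c0)%N.
  apply: boolp.contrapT => h; apply: ntriv => z gz; rewrite leqNgt; apply/negP => sz1.
  by apply: h; exists z.
have [ss|nss] := boolp.pselect (forall a, nilpart a = 0).
  exact: case_semisimple gc sc a b ha.
have [t dt] : exists t, nilpart t != 0.
  by apply: boolp.contrapT => h; apply: nss => z; apply/eqP/negPn/negP => hz; apply: h; exists z.
have [nil|nnil] := boolp.pselect (forall c u, weight D c u -> u != 0 -> c = 0).
  by exists 1%N => m m1; apply: (case_nilpotent char0 leib decA nil); apply: ha.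
have [nu [u [gu [u0 nu0]]]] : exists nu u, [/\ weight D nu u, u != 0 & nu != 0].
  apply: boolp.contrapT => h; apply: nnil => c u gu u0; apply/eqP/negPn/negP => c0'.
  by apply: h; exists c, u.
by exists 0%N => m _; apply: (case_slice gc sc nu0 gu u0 dt).
Qed.
End Cases.

(** * Reduction to split derivations *)

Section Pact.
Variable k : fieldType.
Notation A := {mpoly k[2]}.
Variable D : {linear A -> A}.
Implicit Types (p q : {poly k}) (v : A).

(** The action of k[X] on A in which 'X acts as D. *)
Definition poly_act p v : A := \sum_(i < size p) p`_i *: iter i D v.

Lemma poly_actE p v N : (size p <= N)%N -> poly_act p v = \sum_(i < N) p`_i *: iter i D v.
Proof.
move=> sp; rewrite /poly_act (big_ord_widen N (fun i => p`_i *: iter i D v) sp) big_mkcond /=.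
apply: eq_bigr => i _; case: ltnP => // h.
by rewrite nth_default // scale0r.
Qed.
Lemma poly_actD p q v : poly_act (p + q) v = poly_act p v + poly_act q v.
Proof.
pose N := (size p + size q)%N.
have sp : (size p <= N)%N by apply: leq_addr.
have sq : (size q <= N)%N by apply: leq_addl.
have sd : (size (p + q)%R <= N)%N.
  by apply: leq_trans (size_polyD _ _) _; rewrite geq_max sp sq.
rewrite (poly_actE _ sp) (poly_actE _ sq) (poly_actE _ sd) -big_split /=.
by apply: eq_bigr => i _; rewrite coefD scalerDl.
Qed.
Lemma poly_actC c v : poly_act c%:P v = c *: v.
Proof. by rewrite (@poly_actE _ _ 1) ?size_polyC ?leq_b1 // big_ord1 coefC. Qed.
Lemma poly_actX p v : poly_act (p * 'X) v = poly_act p (D v).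
Proof.
have sp : (size (p * 'X)%R <= (size p).+1)%N.
  by apply: leq_trans (size_polyMleq _ _) _; rewrite size_polyX addn2.
rewrite (poly_actE _ sp) big_ord_recl coefMX scale0r add0r; apply: eq_bigr => i _.
by rewrite lift0 coefMX -iterSr.
Qed.
Lemma poly_act_der p v : poly_act p (D v) = D (poly_act p v).
Proof.
rewrite /poly_act raddf_sum; apply: eq_bigr => i _.
by rewrite /= linearZ /= -iterS iterSr.
Qed.
Lemma poly_actM p q v : poly_act (p * q) v = poly_act p (poly_act q v).
Proof.
elim/poly_ind: p v => [|p c IH] v.
  by rewrite mul0r /poly_act size_poly0 !big_ord0.
rewrite mulrDl !poly_actD mulrAC !poly_actX IH poly_act_der; congr (_ + _).
have sc : (size (c%:P * q)%R <= size q)%N.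
  by rewrite mul_polyC size_scale_leq.
rewrite poly_actC (poly_actE _ sc) /poly_act scaler_sumr; apply: eq_bigr => i _.
by rewrite coefCM scalerA.
Qed.
Lemma poly_act_roots rs v :
  poly_act (\prod_(r <- rs) ('X - r%:P)) v = foldl (fun v c => shift D c v) v rs.
Proof.
elim: rs v => [|r rs IH] v; first by rewrite big_nil -[1]/(1%:P) poly_actC scale1r.
rewrite big_cons mulrC poly_actM IH /= -[in 'X](mul1r 'X) poly_actD poly_actX -polyCN !poly_actC.
by rewrite scale1r scaleNr.
Qed.
End Pact.

(** The n+1 iterates of a, from the first one on, lie in a space spanned by n elements. *)
Lemma annihilator (k : fieldType) (D : {linear {mpoly k[2]} -> {mpoly k[2]}}) :
  locally_finite D -> forall a, exists2 p, p != 0 & poly_act D p a = 0.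
Proof.
move=> hD a; have [n [e [_ He]]] := hD a.
have hsp (i : 'I_n.+1) : exists c : 'I_n -> k, iter i.+1 D a = \sum_(j < n) c j *: e j.
  apply: He; exists 1%N, (fun=> 1), (fun=> iter i.+1 D a); split.
    by move=> _; exists i.+1.
  by rewrite big_ord1 scale1r.
have [c Hc] := fin_all_exists hsp.
have [|al [i0 ai0] Hal] := @lin_dep k _ _ c; first by rewrite !card_ord.
exists ((\poly_(i < n.+1) al (inord i)) * 'X).
  rewrite mulf_neq0 ?polyX_eq0 //; apply: contraNneq ai0 => E.
  by rewrite -(coef0 _ i0) -E coef_poly ltn_ord inord_val.
rewrite poly_actX (@poly_actE _ _ _ _ n.+1) ?size_poly //.
transitivity (\sum_(i < n.+1) \sum_(j < n) (al i * c i j) *: e j).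
  apply: eq_bigr => i _; rewrite coef_poly ltn_ord inord_val -iterSr Hc scaler_sumr.
  by apply: eq_bigr => j _; rewrite scalerA.
rewrite exchange_big big1 // => j _; rewrite -scaler_suml Hal scale0r //.
Qed.

Lemma extp_poly_act (k k' : fieldType) (e : extension k k') P Q p v :
  extp e (poly_act (der P Q) p v) =
    poly_act (der (extp e P) (extp e Q)) (map_poly (ext_inj e) p) (extp e v).
Proof.
rewrite (@poly_actE _ (der (extp e P) (extp e Q)) _ _ (size p)) ?size_poly // /poly_act rmorph_sum.
apply: eq_bigr => i _; rewrite -!mul_mpolyC rmorphM extpC coef_map; congr (_ * _).
by elim: (nat_of_ord i) => //= j <-; rewrite extp_der.
Qed.

Theorem theorem3p1 (k : fieldType) (hk : [pchar k] =i pred0)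
    (D : {linear {mpoly k[2]} -> {mpoly k[2]}})
    (hder : leibniz D) (hD : locally_finite D) :
  mathieu_subspace (image_of D).
Proof.
split.
  split=> [|c _ _ [u <-] [v <-]]; first by exists 0; rewrite raddf0.
  by exists (c *: u + v); rewrite linearP.
have char0 n : (n.+1)%:R != 0 :> k.
  by have /pcharf0P h := hk; rewrite h.
move=> a ha b; set P := D 'X_iX; set Q := D 'X_iY.
have DE := derE hder.
have pE p v : poly_act D p v = poly_act (der P Q) p v.
  rewrite /poly_act; apply: eq_bigr => i _; congr (_ *: _).
  by elim: (nat_of_ord i) => //= j ->; rewrite DE.
have [p p0 Ep] := annihilator hD 'X_iX; have [q q0 Eq] := annihilator hD 'X_iY.
rewrite pE in Ep; rewrite pE in Eq.
have [k' [e [rs Ers]]] := ext_split (mulf_neq0 p0 q0).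
have chk' := ext_char0 (ext_inj e) char0.
set D' := der (extp e P) (extp e Q).
have decx x : poly_act (der P Q) (p * q) x = 0 -> decomposable D' (extp e x).
  move=> h; apply: (@decomposable_roots _ _ rs); rewrite -poly_act_roots.
  have := extp_poly_act e P Q (p * q) x; rewrite h rmorph0 Ers -mul_polyC poly_actM poly_actC.
  move/esym/eqP; rewrite scaler_eq0 fmorph_eq0 lead_coef_eq0 mulf_eq0 (negPf p0) (negPf q0) /=.
  by move/eqP.
have decA : forall x, decomposable D' x.
  apply: decomposable_all; first exact: der_leibniz.
    rewrite -(extpX e); apply: decx.
    by rewrite mulrC poly_actM Ep /poly_act big1 // => i _; rewrite iter_additive0 scaler0.
  rewrite -(extpX e); apply: decx.
  by rewrite poly_actM Eq /poly_act big1 // => i _; rewrite iter_additive0 scaler0.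
have [|N HN] := mathieu_of_decomposition chk' (der_leibniz _ _) decA (a := extp e a) (extp e b).
  move=> m m1; have [c Ec] := ha m m1; exists (extp e c).
  by rewrite /D' /= -extp_der -DE Ec rmorphXn.
exists N => m Nm; have [v Ev] := HN m Nm; exists (retp e v).
rewrite /= in Ev; by rewrite DE -retp_der -/P -/Q Ev -rmorphXn -rmorphM extpK.
Qed.
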